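(* Let $n\geq 3$. Positive semi-definiteness of the matrices displayed below for every $z\in\overline{\mathbb{D}}$ is not sufficient for the existence of a holomorphic interpolant into $\Omega_n$ for non-derogatory data. That is, there exist a positive integer $M$, distinct points $\zeta_1,\dots,\zeta_M\in\mathbb{D}$ and non-derogatory matrices $W_1,\dots,W_M\in\Omega_n$ such that $$\left[\frac{1-\overline{f(z;W_j)}\,f(z;W_k)}{1-\overline{\zeta_j}\,\zeta_k}\right]_{j,k=1}^M \ \geq \ 0\quad\text{for each } z\in\overline{\mathbb{D}},$$ but there is no holomorphic map $F:\mathbb{D}\longrightarrow\Omega_n$ satisfying $F(\zeta_j)=W_j$ for all $j=1,\dots,M$.
   Context: $\mathbb{D}$ is the open unit disc in $\mathbb{C}$ centered at $0$. $M_n(\mathbb{C})$ is the space of $n\times n$ complex matrices, $r(W)$ is the spectral radius of $W\in M_n(\mathbb{C})$, and $\Omega_n:=\{W\in M_n(\mathbb{C}): r(W)<1\}$ is the spectral unit ball, viewed as an open subset of $\mathbb{C}^{n^2}$. A matrix $A\in M_n(\mathbb{C})$ is non-derogatory if each eigenvalue of $A$ has geometric multiplicity $1$ (regardless of its algebraic multiplicity); equivalently, $A$ is similar to the companion matrix of its characteristic polynomial. For $W\in M_n(\mathbb{C})$ write its characteristic polynomial as $\chi^W(z)=z^n+\sum_{j=1}^n(-1)^js_j(W)z^{n-j}$, put $s_0(W):=1$, and define the rational function $$f(z;W):=\frac{\sum_{j=1}^n j\,s_j(W)(-1)^jz^{j-1}}{\sum_{j=0}^{n-1}(n-j)\,s_j(W)(-1)^jz^{j}}.$$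 For $W\in\Omega_n$ this function has no poles in $\overline{\mathbb{D}}$. For a Hermitian matrix, ''$\geq 0$'' means positive semi-definite. *)

(* Defs.v *)
From mathcomp Require Import all_boot all_order all_algebra.
From mathcomp Require Import complex.
From mathcomp Require Import all_classical all_reals all_analysis.

Set Implicit Arguments.
Unset Strict Implicit.
Unset Printing Implicit Defensive.
Import Order.TTheory GRing.Theory Num.Theory.
Import numFieldNormedType.Exports.

Local Open Scope classical_set_scope.
Local Open Scope ring_scope.
Local Open Scope sesquilinear_scope.

Section Definitions.
Variable R : realType.
Local Notation C := (R[i]).

(* The norm `|z| takes its values in R[i]; on R[i], x < y compares real parts
   and requires equal imaginary parts. *)
Definition unit_disc : set C := [set z | `|z| < 1].

Definition closed_unit_disc : set C := [set z | `|z| <= 1].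

(* Re (of a real complex number) only serves to land in R, where sup lives. *)
Definition spectral_radius n (W : 'M[C]_n) : R :=
  sup [set complex.Re `|a| | a in [set a | eigenvalue W a]].

Definition spectral_ball n : set 'M[C]_n := [set W | spectral_radius W < 1].

(* eigenspace W a consists of the row vectors u such that u *m W = a *: u; it
   has the same dimension as the space of column eigenvectors. *)
Definition non_derogatory n (W : 'M[C]_n) : Prop :=
  forall a : C, eigenvalue W a -> \rank (eigenspace W a) = 1%N.

(* Defined by char_poly W = 'X^n + \sum_(1 <= j <= n) (-1)^j s_j 'X^(n - j),
   hence only meaningful for j <= n. *)
Definition char_coef n (W : 'M[C]_n) (j : nat) : C :=
  (-1) ^+ j * (char_poly W)`_(n - j).

Definition f_num n (z : C) (W : 'M[C]_n) : C :=
  \sum_(1 <= j < n.+1) j%:R * char_coef W j * (-1) ^+ j * z ^+ j.-1.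

Definition f_den n (z : C) (W : 'M[C]_n) : C :=
  \sum_(0 <= j < n) (n - j)%:R * char_coef W j * (-1) ^+ j * z ^+ j.

(* For W in the spectral ball the denominator has no zero in the closed disc
   (Gauss-Lucas), so the convention x / 0 = 0 plays no role there. *)
Definition f_val n (z : C) (W : 'M[C]_n) : C := f_num z W / f_den z W.

Definition psd_mx m (H : 'M[C]_m) : Prop :=
  H \is hermsymmx /\ forall u : 'cV[C]_m, 0 <= (u ^t* *m H *m u) 0 0.

Definition pick_mx n M (z : C) (zeta : 'I_M -> C) (W : 'I_M -> 'M[C]_n) :
    'M[C]_M :=
  \matrix_(j, k) ((1 - (f_val z (W j))^* * f_val z (W k)) /
                  (1 - (zeta j)^* * zeta k)).

(* The disc is open, so the values of F outside of it are irrelevant. *)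
Definition holomorphic_on_disc n (F : C -> 'M[C]_n) : Prop :=
  forall z, unit_disc z -> derivable (F : C^o -> 'M[C]_n) z 1.

End Definitions.

(* Main.v *)
Require Import Defs.
From mathcomp Require Import all_boot all_order all_algebra.
From mathcomp Require Import complex.
From mathcomp Require Import all_classical all_reals all_analysis.
From mathcomp Require Import separable cyclotomic.
From mathcomp Require Import ring lra zify.

Set Implicit Arguments.
Unset Strict Implicit.
Unset Printing Implicit Defensive.
Import Order.TTheory GRing.Theory Num.Theory.
Import numFieldNormedType.Exports.

Local Open Scope classical_set_scope.
Local Open Scope ring_scope.

(** Two nodes, [0] and [1 / 2], suffice. Let [m = n - 1] and
    [c = n / (n + m)], and let [W_1], [W_2] be companion matrices with
    characteristic polynomials [X^n] and [X^n - c X]. Then [f(z; W_1) = 0],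
    while [f(z; W_2) = - m c z^(m-1) / (n - c z^m)] has modulus at most [1 / 2]
    on the closed disc ([data_f_bound]); this makes every Pick matrix positive
    semi-definite ([psd_2x2]). On the unit circle the bound [1 / 2] is attained
    at the [m]-th roots of unity, and the defect from it is of the order of
    [|z^m - 1|^2] ([data_defect]).

    Suppose that [F] interpolates the data. For [|z| = 1] the function
    [g(l) = f(z; F l)] maps the disc into the closed disc ([f_circle]) and
    vanishes at [0], so [h(l) = g(l) / l] is bounded by [1]. The Schwarz-Pick
    inequality for [h] between [1 / 2] and [- 1 / 2] reads
    [|h(- 1 / 2) - h(1 / 2)| <= 4 (1 - |h(1 / 2)|^2)], and the right-hand side
    is [O(|z^m - 1|^2)]. After clearing denominators the left-hand side is a
    polynomial in [z] of degree at most [2 m] ([cross_poly]), which must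
    therefore be a multiple of [(z^m - 1)^2]; since [m >= 2], its coefficients
    of degrees [m - 1] and [2 m - 1] vanish ([circle_square_coef]). If [x] is
    the coefficient of degree [1] of the characteristic polynomial of
    [F (- 1 / 2)], these coefficients are [n m (x - c)] and [- 2 m c x]
    ([cross_poly_coef1], [cross_poly_coef2]), and they cannot both be zero.

    The map [F] is only assumed to be complex differentiable at each point.
    The function theory therefore starts from Goursat's lemma ([goursat]); in
    logarithmic polar coordinates it yields the mean value inequality
    ([mean_value_le]), hence the maximum principle ([disc_max]), which extends
    to bounded functions with isolated singularities ([punctured_disc_max]) and
    so gives [schwarz] and [schwarz_pick]. *)

(** * Closed forms on rectangles *)

Section SegmentIntegral.
Variable R : realType.
Implicit Types (f g : R -> R) (a b : R).

(** The integral of [f] over [[a, b]], meant for [a <= b]. *)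
Definition int_seg f a b : R :=
  \int[@lebesgue_measure R]_(x in `[a, b]) f x.

(** Two-sided continuity at every point of [[a, b]], endpoints included. *)
Definition continuous_seg f a b :=
  forall x, a <= x <= b -> {for x, continuous f}.

Lemma int_seg_integrable f a b : continuous_seg f a b ->
  (@lebesgue_measure R).-integrable `[a, b] (EFin \o f).
Proof.
move=> cf; apply: continuous_compact_integrable; first exact: segment_compact.
apply: continuous_in_subspaceT => x /set_mem /=; rewrite in_itv /=.
exact: cf.
Qed.

Lemma continuous_segS f a b a' b' : a <= a' -> b' <= b ->
  continuous_seg f a b -> continuous_seg f a' b'.
Proof.
move=> aa' bb' cf x /andP[ax xb]; apply: cf.
by rewrite (le_trans aa' ax) (le_trans xb bb').
Qed.

Lemma continuous_segB f g a b : continuous_seg f a b ->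
  continuous_seg g a b -> continuous_seg (fun x => f x - g x) a b.
Proof. by move=> cf cg x xab; apply: continuousB; [exact: cf|exact: cg]. Qed.

Lemma int_seg_chasles f a m b : a <= m -> m <= b -> continuous_seg f a b ->
  int_seg f a b = int_seg f a m + int_seg f m b.
Proof.
move=> am mb cf; have if_ := int_seg_integrable cf.
have := @Rintegral_itvB _ f (BLeft a) (BRight b) m if_.
rewrite !bnd_simp => /(_ am mb) /(canRL (subrK _)); rewrite {1}/int_seg => ->.
rewrite addrC /int_seg Rintegral_itv_obnd_cbnd //.
apply: integrableS if_ => //.
by apply: subset_itvr; rewrite bnd_simp.
Qed.

Lemma int_segD f g a b : continuous_seg f a b -> continuous_seg g a b ->
  int_seg (fun x => f x + g x) a b = int_seg f a b + int_seg g a b.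
Proof. by move=> cf cg; apply: RintegralD => //; exact: int_seg_integrable. Qed.

Lemma eq_int_seg f g a b : (forall x, a <= x <= b -> f x = g x) ->
  int_seg f a b = int_seg g a b.
Proof.
by move=> fg; apply: eq_Rintegral => x /set_mem /=; rewrite in_itv /=; exact: fg.
Qed.

Lemma int_seg_cst (k : R) a b : a <= b -> int_seg (fun=> k) a b = k * (b - a).
Proof.
move=> ab; rewrite /int_seg Rintegral_cst //=.
by rewrite lebesgue_measure_itv /= lte_fin; case: ltP => //= ba;
  rewrite (@le_anti _ _ a b) ?ab // subrr.
Qed.

Lemma le_int_seg f g a b : continuous_seg f a b -> continuous_seg g a b ->
  (forall x, a <= x <= b -> f x <= g x) -> int_seg f a b <= int_seg g a b.
Proof.
by move=> cf cg fg; apply: le_Rintegral => //; exact: int_seg_integrable.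
Qed.

Lemma continuous_seg_cst (k : R) a b : continuous_seg (fun=> k) a b.
Proof. by move=> x _; exact: cst_continuous. Qed.

(** If [f] is within [e] of [k], its integral is within [e (b - a)] of
    [k (b - a)]. *)
Lemma int_seg_near f k e a b : a <= b -> continuous_seg f a b ->
  (forall x, a <= x <= b -> `|f x - k| <= e) ->
  `|int_seg f a b - k * (b - a)| <= e * (b - a).
Proof.
move=> ab cf fk; rewrite ler_distl -mulrBl -mulrDl -!int_seg_cst //.
apply/andP; split; (apply: le_int_seg => //; try exact: continuous_seg_cst);
  by move=> x /fk; rewrite ler_distl => /andP[].
Qed.

End SegmentIntegral.

Section Goursat.
Variable R : realType.

Lemma half_pow2 (u : R) k : u / 2 ^+ k = u / 2 ^+ k.+1 + u / 2 ^+ k.+1.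
Proof. by rewrite exprS invfM mulrA -mulrDl; congr (_ * _); lra. Qed.

(** Bisecting a rectangle over and over yields rectangles shrinking to a point;
    [bad k x y] speaks of the rectangle with lower left corner [(x, y)] and
    sides [w / 2 ^ k] and [h / 2 ^ k]. *)
Lemma rectangle_bisection (w h : R) (bad : nat -> R -> R -> Prop) x0 y0 :
    0 <= w -> 0 <= h -> bad 0%N x0 y0 ->
    (forall k x y, bad k x y -> exists i j : bool,
      bad k.+1 (x + i%:R * (w / 2 ^+ k.+1)) (y + j%:R * (h / 2 ^+ k.+1))) ->
  exists s t, forall k, exists x y, [/\ bad k x y,
    x <= s <= x + w / 2 ^+ k & y <= t <= y + h / 2 ^+ k].
Proof.
move=> w0 h0 bad0 badS.
pose X := {p : nat * R * R | bad p.1.1 p.1.2 p.2}.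
pose next (p q : X) := exists i j : bool,
  sval q = ((sval p).1.1.+1,
            (sval p).1.2 + i%:R * (w / 2 ^+ (sval p).1.1.+1),
            (sval p).2 + j%:R * (h / 2 ^+ (sval p).1.1.+1)).
have nextP p : {q : X | next p q}.
  apply: cid; case: p => -[[k x] y] /= bp.
  have [i [j bq]] := badS _ _ _ bp.
  by exists (exist _ (k.+1, _, _) bq), i, j.
have [f [f0 fS]] := dependent_choice nextP (exist _ (0%N, x0, y0) bad0 : X).
have fk k : (sval (f k)).1.1 = k.
  by elim: k => [|k IH]; [rewrite f0|have [i [j ->]] := fS k; rewrite /= IH].
have limit (u : R) (g : nat -> R) : 0 <= u ->
    (forall k, exists i : bool, g k.+1 = g k + i%:R * (u / 2 ^+ k.+1)) ->
    exists s, forall k, g k <= s <= g k + u / 2 ^+ k.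
  move=> u0 gS.
  have uk0 k : 0 <= u / 2 ^+ k by rewrite divr_ge0 // exprn_ge0.
  have g_nd k l : g k <= g (l + k)%N.
    elim: l => //= l IH; rewrite addSn (le_trans IH) //.
    by have [i ->] := gS (l + k)%N; rewrite lerDl mulr_ge0.
  have g_ni k l : g (l + k)%N + u / 2 ^+ (l + k) <= g k + u / 2 ^+ k.
    elim: l => //= l IH; rewrite addSn (le_trans _ IH) //.
    have [i ->] := gS (l + k)%N; rewrite (half_pow2 _ (l + k)%N).
    by case: i; rewrite ?mul1r ?mul0r ?addr0 addrA ?lerDl // lexx.
  have g_ub k l : g l <= g k + u / 2 ^+ k.
    have [kl|/ltnW lk] := leqP k l.
      by apply: le_trans (g_ni k (l - k)%N); rewrite subnK // lerDl.
    by rewrite (le_trans (g_nd l (k - l)%N)) // subnK // lerDl.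
  exists (sup (range g)) => k; apply/andP; split.
    apply: ub_le_sup; last by exists k.
    by exists (g 0%N + u / 2 ^+ 0) => _ [l _ <-].
  by apply: ge_sup => [|_ [l _ <-]]; [exists (g 0%N), 0%N|].
have [|s sP] := limit w (fun k => (sval (f k)).1.2) w0.
  by move=> k; have [i [j fkS]] := fS k; exists i; rewrite fkS /= fk.
have [|t tP] := limit h (fun k => (sval (f k)).2) h0.
  by move=> k; have [i [j fkS]] := fS k; exists j; rewrite fkS /= fk.
exists s, t => k; exists (sval (f k)).1.2, (sval (f k)).2; split => //.
by move: (svalP (f k)); rewrite fk.
Qed.

Variables P Q : R -> R -> R.

(** The integral of [P ds + Q dt] along the boundary of [[a, b] x [c, d]]. *)
Definition rect_int a b c d : R :=
  int_seg (fun s => P s c - P s d) a b + int_seg (fun t => Q b t - Q a t) c d.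

(** [P ds + Q dt] is closed at [(s, t)]: both coefficients are differentiable
    there, and [k] is the common value of [dP/dt] and [dQ/ds]. *)
Definition closed_form_at s0 t0 := exists p q k : R, forall e, 0 < e ->
  exists2 r, 0 < r & forall s t, `|s - s0| <= r -> `|t - t0| <= r ->
    `|P s t - P s0 t0 - p * (s - s0) - k * (t - t0)|
      <= e * (`|s - s0| + `|t - t0|) /\
    `|Q s t - Q s0 t0 - k * (s - s0) - q * (t - t0)|
      <= e * (`|s - s0| + `|t - t0|).

(** [P] is continuous along horizontal and [Q] along vertical segments of the
    rectangle: all that the boundary integrals of its sub-rectangles require. *)
Definition continuous_form a b c d :=
  (forall t, c <= t <= d -> continuous_seg (P ^~ t) a b) /\
  (forall s, a <= s <= b -> continuous_seg (Q s) c d).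

Lemma continuous_formS a b c d a' b' c' d' :
    a <= a' -> a' <= b' -> b' <= b -> c <= c' -> c' <= d' -> d' <= d ->
  continuous_form a b c d -> continuous_form a' b' c' d'.
Proof.
move=> aa ab bb cc cd dd [cP cQ]; split=> [t|s] /andP[h1 h2].
  apply: (continuous_segS aa bb); apply: cP.
  by rewrite (le_trans cc h1) (le_trans h2 dd).
apply: (continuous_segS cc dd); apply: cQ.
by rewrite (le_trans aa h1) (le_trans h2 bb).
Qed.

Lemma rect_int_splitl a m b c d : a <= m -> m <= b -> c <= d ->
  continuous_form a b c d ->
  rect_int a b c d = rect_int a m c d + rect_int m b c d.
Proof.
move=> am mb cd [cP cQ]; have ab := le_trans am mb.
have cC : c <= c <= d by rewrite lexx.
have dD : c <= d <= d by rewrite lexx andbT.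
have aA : a <= a <= b by rewrite lexx.
have bB : a <= b <= b by rewrite lexx andbT.
have mM : a <= m <= b by rewrite am.
rewrite /rect_int (int_seg_chasles am mb); last first.
  by apply: continuous_segB; apply: cP.
rewrite [int_seg (fun t => Q b t - Q a t) _ _](_ : _ =
  int_seg (fun t => (Q m t - Q a t) + (Q b t - Q m t)) c d); last first.
  by apply: eq_int_seg => t _; lra.
rewrite (@int_segD _ (fun t => Q m t - Q a t)) 1?addrACA //.
  by apply: continuous_segB; apply: cQ.
by apply: continuous_segB; apply: cQ.
Qed.

Lemma rect_int_splitr a b c m d : a <= b -> c <= m -> m <= d ->
  continuous_form a b c d ->
  rect_int a b c d = rect_int a b c m + rect_int a b m d.
Proof.
move=> ab cm md [cP cQ]; have cd := le_trans cm md.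
have cC : c <= c <= d by rewrite lexx.
have dD : c <= d <= d by rewrite lexx andbT.
have aA : a <= a <= b by rewrite lexx.
have bB : a <= b <= b by rewrite lexx andbT.
have mM : c <= m <= d by rewrite cm.
rewrite /rect_int (int_seg_chasles cm md); last first.
  by apply: continuous_segB; apply: cQ.
rewrite [int_seg (fun s => P s c - P s d) _ _](_ : _ =
  int_seg (fun s => (P s c - P s m) + (P s m - P s d)) a b); last first.
  by apply: eq_int_seg => s _; lra.
rewrite (@int_segD _ (fun s => P s c - P s m)) 1?addrACA //.
  by apply: continuous_segB; apply: cP.
by apply: continuous_segB; apply: cP.
Qed.

Lemma dist_le_length (a b x y : R) : a <= x <= b -> a <= y <= b ->
  `|x - y| <= b - a.
Proof.
move=> /andP[ax xb] /andP[ay yb].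
by rewrite ler_norml opprB !lerB.
Qed.

Lemma norm_sub_bound (e w h u1 v1 u2 v2 x1 x2 : R) : 0 < e ->
    `|x1| <= e / 2 * (u1 + v1) -> `|x2| <= e / 2 * (u2 + v2) ->
    u1 <= w -> v1 <= h -> u2 <= w -> v2 <= h ->
  `|x1 - x2| <= e * (w + h).
Proof.
move=> e0 h1 h2 u1w v1h u2w v2h.
rewrite (le_trans (ler_normB _ _)) // (le_trans (lerD h1 h2)) //.
by rewrite -mulrDr -mulrA ler_pM2l //; lra.
Qed.

(** Near a point where the form is closed the affine parts of [P] and [Q]
    contribute nothing to the boundary integral, so that only an arbitrarily
    small multiple of the square of the size of the rectangle is left. *)
Lemma rect_int_small s0 t0 : closed_form_at s0 t0 ->
  forall e, 0 < e -> exists2 r, 0 < r & forall a b c d,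
    a <= s0 <= b -> c <= t0 <= d -> b - a <= r -> d - c <= r ->
    continuous_form a b c d ->
    `|rect_int a b c d| <= e * ((b - a) + (d - c)) ^+ 2.
Proof.
move=> [p [q [k H]]] e e0; have e20 : 0 < e / 2 by rewrite divr_gt0.
have [r r0 {}H] := H _ e20; exists r => // a b c d.
move=> /andP[as0 s0b] /andP[ct0 t0d] br dr [cP cQ].
have ab := le_trans as0 s0b; have cd := le_trans ct0 t0d.
set D := (b - a) + (d - c).
have P1 s : a <= s <= b -> `|P s c - P s d - k * (c - d)| <= e * D.
  move=> sab; have hs : `|s - s0| <= b - a by apply: dist_le_length; rewrite ?as0.
  have hc : `|c - t0| <= d - c by apply: dist_le_length; rewrite ?lexx ?ct0.
  have hd : `|d - t0| <= d - c by apply: dist_le_length; rewrite ?lexx ?ct0 ?cd.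
  have [h1 _] := H s c (le_trans hs br) (le_trans hc dr).
  have [h2 _] := H s d (le_trans hs br) (le_trans hd dr).
  rewrite (_ : P s c - _ - _ = (P s c - P s0 t0 - p * (s - s0) - k * (c - t0))
    - (P s d - P s0 t0 - p * (s - s0) - k * (d - t0))); last by ring.
  exact: (norm_sub_bound e0 h1 h2).
have Q1 t : c <= t <= d -> `|Q b t - Q a t - k * (b - a)| <= e * D.
  move=> tcd; have ht : `|t - t0| <= d - c by apply: dist_le_length; rewrite ?ct0.
  have hb : `|b - s0| <= b - a by apply: dist_le_length; rewrite ?lexx ?as0 ?ab.
  have ha : `|a - s0| <= b - a by apply: dist_le_length; rewrite ?lexx ?as0.
  have [_ h1] := H b t (le_trans hb br) (le_trans ht dr).
  have [_ h2] := H a t (le_trans ha br) (le_trans ht dr).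
  rewrite (_ : Q b t - _ - _ = (Q b t - Q s0 t0 - k * (b - s0) - q * (t - t0))
    - (Q a t - Q s0 t0 - k * (a - s0) - q * (t - t0))); last by ring.
  exact: (norm_sub_bound e0 h1 h2).
have cC : c <= c <= d by rewrite lexx.
have dD : c <= d <= d by rewrite lexx andbT.
have aA : a <= a <= b by rewrite lexx.
have bB : a <= b <= b by rewrite lexx andbT.
have hP := int_seg_near ab (continuous_segB (cP _ cC) (cP _ dD)) P1.
have hQ := int_seg_near cd (continuous_segB (cQ _ bB) (cQ _ aA)) Q1.
rewrite /rect_int; set IP := int_seg _ a b in hP *.
set IQ := int_seg _ c d in hQ *.
rewrite (_ : IP + IQ = (IP - k * (c - d) * (b - a)) + (IQ - k * (b - a) * (d - c)));
  last by ring.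
rewrite (le_trans (ler_normD _ _)) // (le_trans (lerD hP hQ)) //.
by rewrite -mulrDr expr2 mulrA.
Qed.

(** Goursat's lemma: no continuity of the partial derivatives is needed. *)
Lemma goursat a b c d : a <= b -> c <= d -> continuous_form a b c d ->
  (forall s t, a <= s <= b -> c <= t <= d -> closed_form_at s t) ->
  rect_int a b c d = 0.
Proof.
move=> ab cd cF closed; apply/eqP; rewrite -normr_le0; apply/ler_addgt0Pl => e e0.
rewrite addr0; set w := b - a; set h := d - c; set I := `|_|.
have w0 : 0 <= w by rewrite subr_ge0.
have h0 : 0 <= h by rewrite subr_ge0.
pose bad k x y := [/\ a <= x, x + w / 2 ^+ k <= b, c <= y, y + h / 2 ^+ k <= d &
  I <= 4 ^+ k * `|rect_int x (x + w / 2 ^+ k) y (y + h / 2 ^+ k)|].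
have bad0 : bad 0%N a c.
  by rewrite /bad !expr0 !divr1 !lexx mul1r /w /h ![_ + (_ - _)]addrC !subrK !lexx.
have pk0 (u : R) k : 0 <= u -> 0 <= u / 2 ^+ k.
  by move=> u0; rewrite divr_ge0 // exprn_ge0.
have badS k x y : bad k x y -> exists i j : bool,
    bad k.+1 (x + i%:R * (w / 2 ^+ k.+1)) (y + j%:R * (h / 2 ^+ k.+1)).
  case=> ax xb cy yd; rewrite (half_pow2 w) (half_pow2 h) in xb yd *.
  set w' := w / 2 ^+ k.+1 in xb *; set h' := h / 2 ^+ k.+1 in yd *.
  have w'0 : 0 <= w' by apply: pk0.
  have h'0 : 0 <= h' by apply: pk0.
  rewrite !addrA in xb yd *.
  have cF' : continuous_form x (x + w' + w') y (y + h' + h').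
    by apply: continuous_formS cF => //; lra.
  rewrite (@rect_int_splitl _ (x + w')); [|lra|lra|lra|by []].
  rewrite (@rect_int_splitr x _ _ (y + h')); [|lra|lra|lra|]; last first.
    by apply: continuous_formS cF => //; lra.
  rewrite (@rect_int_splitr (x + w') _ _ (y + h')); [|lra|lra|lra|]; last first.
    by apply: continuous_formS cF => //; lra.
  set I1 := rect_int _ _ _ _; set I2 := rect_int _ _ _ _.
  set I3 := rect_int _ _ _ _; set I4 := rect_int _ _ _ _ => hI.
  (* one of the four quarters carries at least a quarter of the integral *)
  have [m [mI]] : exists m, I <= 4 ^+ k.+1 * `|m| /\
      [\/ m = I1, m = I2, m = I3 | m = I4].
    apply: contrapT => no.
    have lt m : [\/ m = I1, m = I2, m = I3 | m = I4] -> 4 ^+ k.+1 * `|m| < I.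
      by move=> mI; rewrite ltNge; apply/negP => Im; apply: no; exists m.
    have /lt m1 : [\/ I1 = I1, I1 = I2, I1 = I3 | I1 = I4] by constructor 1.
    have /lt m2 : [\/ I2 = I1, I2 = I2, I2 = I3 | I2 = I4] by constructor 2.
    have /lt m3 : [\/ I3 = I1, I3 = I2, I3 = I3 | I3 = I4] by constructor 3.
    have /lt m4 : [\/ I4 = I1, I4 = I2, I4 = I3 | I4 = I4] by constructor 4.
    have : `|I1 + I2 + (I3 + I4)| <= `|I1| + `|I2| + (`|I3| + `|I4|).
      by rewrite (le_trans (ler_normD _ _)) // lerD // ler_normD.
    rewrite -(@ler_pM2l _ (4 ^+ k)) ?exprn_gt0 // => hI'.
    move: m1 m2 m3 m4; rewrite !exprS -!mulrA.
    move: (le_trans hI hI'); rewrite !mulrDr.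
    lra.
  case=> mE; rewrite {}mE in mI.
  - exists false, false; rewrite !mul0r !addr0; split; rewrite -/w' -/h' //; lra.
  - exists false, true; rewrite mul0r mul1r !addr0; split; rewrite -/w' -/h' //; lra.
  - exists true, false; rewrite mul0r mul1r !addr0; split; rewrite -/w' -/h' //; lra.
  - exists true, true; rewrite !mul1r; split; rewrite -/w' -/h' //; lra.
have [s [t stP]] := rectangle_bisection w0 h0 bad0 badS.
have sab : a <= s <= b.
  have [x [y [[ax xb _ _ _] /andP[xs sx] _]]] := stP 0%N.
  by rewrite (le_trans ax xs) (le_trans sx xb).
have tcd : c <= t <= d.
  have [x [y [[_ _ cy yd _] _ /andP[yt ty]]]] := stP 0%N.
  by rewrite (le_trans cy yt) (le_trans ty yd).
pose D := (w + h) ^+ 2 + 1.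
have D0 : 0 < D by rewrite ltr_wpDl // sqr_ge0.
have [r r0 rP] := rect_int_small (closed _ _ sab tcd) (divr_gt0 e0 D0).
have [k wk hk] : exists2 k, w / 2 ^+ k <= r & h / 2 ^+ k <= r.
  have /cvgrPdist_le : (fun k : nat => (w + h) / 2 ^+ k) @ \oo --> (0 : R).
    rewrite -[0](mulr0 (w + h)); apply: cvgM; first exact: cvg_cst.
    under eq_fun do rewrite -exprVn.
    by apply: cvg_expr; rewrite ger0_norm ?invr_ge0 // invf_lt1 // ltr1n.
  move=> /(_ r r0) [k _ /(_ k (leqnn _))] /=.
  rewrite sub0r normrN (ger0_norm (pk0 _ k (addr_ge0 w0 h0))) => hk.
  exists k; apply: le_trans hk; rewrite ler_pM2r ?invr_gt0 ?exprn_gt0 //.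
    by rewrite lerDl.
  by rewrite lerDr.
have [x [y [[ax xb cy yd Ik] xs yt]]] := stP k.
have := pk0 _ k w0; have := pk0 _ k h0 => hk0 wk0.
have := rP _ _ _ _ xs yt.
rewrite ![_ + _ - _]addrC !addKr => /(_ wk hk) small.
apply: (le_trans Ik); rewrite -ler_pdivlMl ?exprn_gt0 //.
apply: le_trans (small _) _.
  by apply: continuous_formS cF => //; lra.
rewrite -mulrDl exprMn exprVn -exprM mulnC exprM (_ : 2 ^+ 2 = 4); last by ring.
rewrite mulrA [leLHS]mulrC ler_pM2l ?invr_gt0 ?exprn_gt0 //.
by rewrite -mulrA ler_piMr ?(ltW e0) // ler_pdivrMl // mulr1 /D lerDl.
Qed.

End Goursat.

(** * Complex differentiability in polar coordinates *)

Lemma derivable_approx (K : numFieldType) (f : K -> K) (x : K) :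
    derivable (f : K^o -> K^o) x 1 ->
  forall e, 0 < e -> exists2 r : K, 0 < r & forall y, `|y - x| < r ->
    `|f y - f x - 'D_1 (f : K^o -> K^o) x * (y - x)| <= e * `|y - x|.
Proof.
move=> df e e0; move/cvgrPdist_le: (df) => /(_ e e0).
rewrite /dnbhs /within /= => /nbhs_ballP[r /= r0 fr]; exists r => // y yx.
have [->|y0] := eqVneq y x; first by rewrite !subrr mulr0 subr0 normr0 mulr0.
have yx0 : y - x != 0 by rewrite subr_eq0.
have := fr (y - x); rewrite -ball_normE /= sub0r normrN => /(_ yx yx0).
rewrite /GRing.scale /= mulr1 subrK -/(derive _ _ _) => h.
rewrite (_ : _ - _ - _ = - ((y - x) *
  ('D_1 (f : K^o -> K^o) x - (y - x)^-1 * (f y - f x)))); last by field.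
by rewrite normrN normrM mulrC ler_wpM2r.
Qed.

Section ComplexPlane.
Variable R : realType.
Local Notation C := R[i].
Local Notation "x %:C" := (real_complex R x).
Implicit Types (z w : C) (v : C -> C).

(** Complex differentiability at [z]; on a one-dimensional space it amounts to
    derivability in the direction [1]. *)
Definition holo v z := differentiable (v : C^o -> C^o) (z : C^o).

Lemma gt0_realE (r : C) : 0 < r -> exists2 x : R, 0 < x & r = x%:C.
Proof.
move=> r0; have /complex_realP[x rE] : r \is Num.real by exact: gtr0_real.
by exists x => //; rewrite -ltcR -rE.
Qed.

Lemma ge0_realE (r : C) : 0 <= r -> exists2 x : R, 0 <= x & r = x%:C.
Proof.
move=> r0; have /complex_realP[x rE] : r \is Num.real by exact: ger0_real.
by exists x => //; rewrite -lecR -rE.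
Qed.

Lemma norm_Re_le z (r : R) : `|z| <= r%:C -> `|complex.Re z| <= r.
Proof. by move=> h; rewrite -lecR (le_trans (normc_ge_Re _)). Qed.

Lemma norm_Im_le z (r : R) : `|z| <= r%:C -> `|complex.Im z| <= r.
Proof.
case: z => a b; rewrite normc_def lecR /= => h; apply: le_trans h.
by rewrite -sqrtr_sqr ler_wsqrtr // lerDr sqr_ge0.
Qed.

Lemma norm_le_ReIm (x y : R) : `|Complex x y| <= (`|x| + `|y|)%:C.
Proof.
rewrite normc_def lecR /= -[leRHS]ger0_norm ?addr_ge0 // -sqrtr_sqr.
by rewrite ler_wsqrtr // sqrrD !real_normK ?num_real // lerD2r lerDl mulrn_wge0 // mulr_ge0.
Qed.

Lemma holo_approx v z : holo v z -> exists d, forall e : R, 0 < e ->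
  exists2 r : R, 0 < r & forall x, `|x - z| < r%:C ->
    `|v x - v z - d * (x - z)| <= e%:C * `|x - z|.
Proof.
move=> /derivable1_diffP dv; exists ('D_1 (v : C^o -> C^o) z) => e e0.
have [|r r0 vr] := derivable_approx dv (e := e%:C); first by rewrite ltcR.
by have [x x0 rE] := gt0_realE r0; rewrite rE in vr; exists x.
Qed.

Lemma real_derivable_approx (f : R -> R) (x d : R) : is_derive x (1 : R) f d ->
  forall e, 0 < e -> exists2 r, 0 < r & forall y, `|y - x| <= r ->
    `|f y - f x - d * (y - x)| <= e * `|y - x|.
Proof.
move=> df e e0; have [r r0 fr] := derivable_approx (@ex_derive _ _ _ _ _ _ _ df) e0.
exists (r / 2); first by rewrite divr_gt0.
move=> y yr; rewrite -(@derive_val _ _ _ _ _ _ _ df); apply: fr.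
by apply: le_lt_trans yr _; lra.
Qed.

(** [exp (s + i t)]. *)
Definition polar (s t : R) : C := Complex (expR s * cos t) (expR s * sin t).

Lemma norm_polar s t : `|polar s t| = (expR s)%:C.
Proof.
rewrite normc_def /= !exprMn -mulrDr cos2Dsin2 mulr1 sqrtr_sqr.
by rewrite ger0_norm ?expR_ge0.
Qed.

Lemma polarD s t s' t' : polar (s + s') (t + t') = polar s t * polar s' t'.
Proof.
by rewrite /polar expRD cosD sinD; simpc; congr Complex; ring.
Qed.

(** The exponential has derivative [1] at [0]. *)
Lemma polar_approx e : 0 < e -> exists2 r : R, 0 < r & forall x y,
  `|x| <= r -> `|y| <= r ->
  `|polar x y - 1 - Complex x y| <= (e * (`|x| + `|y|))%:C.
Proof.
move=> e0; pose e1 := Num.min 1 (e / 3).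
have e10 : 0 < e1 by rewrite lt_min ltr01 divr_gt0.
have e11 : e1 <= 1 by rewrite ge_min lexx.
have e13 : 3 * e1 <= e by rewrite mulrC -ler_pdivlMr // ge_min lexx orbT.
have [r1 r10 h1] := real_derivable_approx (is_derive_expR 0) e10.
have [r2 r20 h2] := real_derivable_approx (is_derive_cos 0) e10.
have [r3 r30 h3] := real_derivable_approx (is_derive_sin 0) e10.
exists (Num.min (Num.min r1 r2) (Num.min r3 (e1 / 2))).
  by rewrite !lt_min r10 r20 r30 divr_gt0.
move=> x y; rewrite !le_min => /andP[/andP[x1 x2] /andP[x3 xe]].
move=> /andP[/andP[y1 y2] /andP[y3 ye]].
have := h1 x; rewrite subr0 expR0 mul1r => /(_ x1) {}h1.
have := h2 y; rewrite subr0 cos0 sin0 oppr0 mul0r subr0 => /(_ y2) {}h2.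
have := h3 y; rewrite subr0 cos0 sin0 mul1r subr0 => /(_ y3) {}h3.
have -> : polar x y - 1 - Complex x y =
    Complex (expR x * cos y - 1 - x) (expR x * sin y - y).
  by rewrite /polar; simpc.
apply: le_trans (norm_le_ReIm _ _) _; rewrite lecR.
have hRe : `|expR x * cos y - 1 - x| <= e1 * `|x| + 2 * (e1 * `|y|).
  rewrite (_ : _ - _ - _ = (expR x - 1 - x) * cos y + (1 + x) * (cos y - 1));
    last by ring.
  rewrite (le_trans (ler_normD _ _)) // !normrM lerD //.
    by rewrite -[leRHS]mulr1 ler_pM // cos_max.
  rewrite ler_pM // (le_trans (ler_normD _ _)) // normr1; lra.
have siny : `|sin y| <= e1.
  rewrite (_ : sin y = (sin y - y) + y); last by ring.
  rewrite (le_trans (ler_normD _ _)) // (le_trans (lerD h3 (lexx _))) //.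
  have : e1 * `|y| <= 1 * `|y| by rewrite ler_wpM2r.
  lra.
have hIm : `|expR x * sin y - y| <= e1 * `|x| + `|x| * e1 + e1 * `|y|.
  rewrite (_ : _ - _ = (expR x - 1 - x) * sin y + x * sin y + (sin y - y));
    last by ring.
  rewrite (le_trans (ler_normD _ _)) // lerD // (le_trans (ler_normD _ _)) //.
  rewrite !normrM lerD // ?ler_wpM2l //.
  by rewrite -[leRHS]mulr1 ler_pM // sin_max.
apply: le_trans (lerD hRe hIm) _.
have := normr_ge0 x; have := normr_ge0 y => y0 x0.
have : 3 * e1 * (`|x| + `|y|) <= e * (`|x| + `|y|) by rewrite ler_wpM2r ?addr_ge0.
lra.
Qed.

(** In the coordinates [z = exp (s + i t)] the form [v(z) dz / z] becomes
    [v ds + i v dt], whose imaginary part is [Im v ds + Re v dt]. *)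
Lemma holo_closed_form v s t : holo v (polar s t) ->
  closed_form_at (fun s t => complex.Im (v (polar s t)))
                 (fun s t => complex.Re (v (polar s t))) s t.
Proof.
set z := polar s t => /holo_approx[d vd]; pose w := d * z.
exists (complex.Im w), (- complex.Im w), (complex.Re w) => e e0.
have [nd nd0 ndE] := ge0_realE (normr_ge0 d).
have [nz nz0 nzE] := ge0_realE (normr_ge0 z).
pose e1 := Num.min 1 (e / 2 / (nd * nz + 1)).
have e10 : 0 < e1 by rewrite lt_min ltr01 !divr_gt0 // ltr_wpDl // mulr_ge0.
have e20 : 0 < e / 4 / (nz + 1) by rewrite !divr_gt0 // ltr_wpDl.
have [r1 r10 h1] := polar_approx e10.
have [r2 r20 h2] := vd _ e20.
exists (Num.min r1 (r2 / 5 / (nz + 1))).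
  by rewrite lt_min r10 !divr_gt0 // ltr_wpDl.
move=> s' t'; set x := s' - s; set y := t' - t.
rewrite !le_min => /andP[x1 x2] /andP[y1 y2].
set z' := polar s' t'.
have z'E : z' = z * polar x y by rewrite -polarD /x /y !(addrC _ (_ - _)) !subrK.
set D := v z' - v z - w * Complex x y.
have DE : D = (v z' - v z - d * (z' - z)) + d * z * (polar x y - 1 - Complex x y).
  by rewrite /D /w z'E; ring.
have N0 : 0 <= `|x| + `|y| by rewrite addr_ge0.
have zz' : `|z' - z| <= (2 * nz * (`|x| + `|y|))%:C.
  have -> : z' - z = z * ((polar x y - 1 - Complex x y) + Complex x y).
    by rewrite z'E; ring.
  rewrite normrM nzE -mulrA mulrCA rmorphM /= ler_wpM2l ?ler0c //.
  apply: le_trans (ler_normD _ _) _.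
  apply: le_trans (lerD (h1 _ _ x1 y1) (norm_le_ReIm _ _)) _.
  rewrite -rmorphD lecR -[X in _ + X]mul1r -mulrDl ler_wpM2r //.
  by rewrite (le_trans (y := 1 + 1)) // lerD2r ge_min lexx.
have D_le : `|D| <= (e * (`|x| + `|y|))%:C.
  rewrite DE; apply: le_trans (ler_normD _ _) _.
  rewrite (_ : e * _ = e / 2 * (`|x| + `|y|) + e / 2 * (`|x| + `|y|)); last by field.
  rewrite rmorphD /= lerD //.
    apply: le_trans (h2 _ _) _.
      apply: le_lt_trans zz' _; rewrite ltcR.
      have : `|x| + `|y| <= 2 * (r2 / 5 / (nz + 1)) by lra.
      have nz1 : 0 < nz + 1 by rewrite ltr_wpDl.
      have q0 : 0 < r2 / 5 / (nz + 1) by rewrite !divr_gt0.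
      have qE : r2 / 5 = (r2 / 5 / (nz + 1)) * (nz + 1).
        by rewrite divfK // gt_eqF.
      set q := r2 / 5 / (nz + 1) in q0 qE * => hq.
      have : nz * (`|x| + `|y|) <= nz * (2 * q) by rewrite ler_wpM2l.
      have : 0 <= nz * q by rewrite mulr_ge0 // ltW.
      move: qE; rewrite mulrDr mulr1; lra.
    apply: le_trans (ler_wpM2l _ zz') _; first by rewrite ler0c ltW.
    rewrite -rmorphM lecR !mulrA ler_wpM2r //.
    have qE : e / 4 = e / 4 / (nz + 1) * (nz + 1).
      by rewrite divfK // gt_eqF // ltr_wpDl.
    by move: e20 qE; set q := e / 4 / _ => e20 qE; lra.
  rewrite !normrM ndE nzE.
  apply: le_trans (ler_wpM2l _ (h1 _ _ x1 y1)) _.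
    by rewrite -rmorphM ler0c mulr_ge0.
  rewrite -!rmorphM lecR mulrA ler_wpM2r //.
  have h : e1 <= e / 2 / (nd * nz + 1) by rewrite ge_min lexx orbT.
  have p0 : 0 <= nd * nz by rewrite mulr_ge0.
  apply: le_trans (ler_wpM2l p0 h) _.
  rewrite mulrA ler_pdivrMr ?ltr_wpDl //; nra.
have ReD : complex.Re D = complex.Re (v z') - complex.Re (v z)
    - complex.Re w * x - - complex.Im w * y.
  by rewrite /D; case: (v z') (v z) (w) => [? ?] [? ?] [? ?] /=; ring.
have ImD : complex.Im D = complex.Im (v z') - complex.Im (v z)
    - complex.Im w * x - complex.Re w * y.
  by rewrite /D; case: (v z') (v z) (w) => [? ?] [? ?] [? ?] /=; ring.
by split; [rewrite -ImD; apply: norm_Im_le|rewrite -ReD; apply: norm_Re_le].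
Qed.

End ComplexPlane.

(** * The maximum principle *)

Lemma near_ballP (K : numFieldType) (z : K) (P : K -> Prop) (r : K) : 0 < r ->
  (forall x, `|x - z| < r -> P x) -> \forall x \near (z : K^o), P x.
Proof.
move=> r0 rP; apply/nbhs_ballP; exists r => //= x.
by rewrite -ball_normE /= distrC; exact: rP.
Qed.

Lemma derivable_quadratic (K : numFieldType) (f : K -> K) (z M r : K) :
    0 < M -> 0 < r ->
    (forall x, `|x - z| < r -> `|f x - f z| <= M * `|x - z| ^+ 2) ->
  derivable (f : K^o -> K^o) z 1.
Proof.
move=> M0 r0 fM; apply: (cvgP (0 : K^o)); apply/cvgrPdist_le => e e0.
rewrite /dnbhs /within /=.
have rN := @near_ballP _ (0 : K) (fun h => `|h - 0| < r) r r0 (fun _ => id).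
have eN := @near_ballP _ (0 : K) (fun h => `|h - 0| < e / M) (e / M)
  (divr_gt0 e0 M0) (fun _ => id).
apply: filterS2 rN eN => h; rewrite subr0 => hr he h0.
rewrite sub0r normrN /GRing.scale /= mulr1 normrM normfV.
rewrite ler_pdivrMl ?normr_gt0 //.
apply: le_trans (fM _ _) _; rewrite addrK //.
rewrite expr2 mulrCA ler_wpM2l // mulrC -ler_pdivlMr //; exact: ltW.
Qed.

Section HoloCalculus.
Variable R : realType.
Local Notation C := R[i].
Implicit Types (z : C) (f g : C -> C).

Lemma holo_cst c z : holo (fun=> c) z.
Proof. exact: differentiable_cst. Qed.

Lemma holo_id z : holo (fun x => x) z.
Proof. by apply/derivable1_diffP; exact: derivable_id. Qed.

Lemma holoD f g z : holo f z -> holo g z -> holo (fun x => f x + g x) z.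
Proof. exact: differentiableD. Qed.

Lemma holoB f g z : holo f z -> holo g z -> holo (fun x => f x - g x) z.
Proof. exact: differentiableB. Qed.

Lemma holoM f g z : holo f z -> holo g z -> holo (fun x => f x * g x) z.
Proof. exact: differentiableM. Qed.

Lemma holoV f z : holo f z -> f z != 0 -> holo (fun x => (f x)^-1) z.
Proof. exact: differentiableV. Qed.

Lemma holoX f n z : holo f z -> holo (fun x => f x ^+ n) z.
Proof.
move=> hf; elim: n => [|n IH].
  by under [X in holo X]eq_fun do rewrite expr0; exact: holo_cst.
by under [X in holo X]eq_fun do rewrite exprS; exact: holoM.
Qed.

Lemma holo_sum (I : Type) (r : seq I) (P : pred I) (F : I -> C -> C) z :
  (forall i, P i -> holo (F i) z) ->
  holo (fun x => \sum_(i <- r | P i) F i x) z.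
Proof.
move=> hF; elim: r => [|i r IH].
  by under [X in holo X]eq_fun do rewrite big_nil; exact: holo_cst.
under [X in holo X]eq_fun do rewrite big_cons.
case: (P i) (hF i) => [hi|_]; last exact: IH.
by apply: holoD; [exact: hi|exact: IH].
Qed.

Lemma holo_comp f g z : holo f z -> holo g (f z) -> holo (fun x => g (f x)) z.
Proof. exact: differentiable_comp. Qed.

Lemma holo_quadratic f z (K r : R) : 0 < r ->
    (forall x, `|x - z| < (real_complex R r) ->
      `|f x - f z| <= (real_complex R K) * `|x - z| ^+ 2) ->
  holo f z.
Proof.
move=> r0 fK; apply/derivable1_diffP.
apply: (@derivable_quadratic _ _ _ (real_complex R (`|K| + 1)) (real_complex R r)).
- by rewrite ltcR ltr_wpDl.
- by rewrite ltcR.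
move=> x xz; apply: le_trans (fK _ xz) _; rewrite ler_wpM2r ?exprn_ge0 //.
by rewrite lecR (le_trans (ler_norm _)) // lerDl.
Qed.

End HoloCalculus.

Section MaximumPrinciple.
Variable R : realType.
Local Notation C := R[i].
Local Notation "x %:C" := (real_complex R x).
Implicit Types (z a : C) (v u : C -> C).

Lemma lipschitz_continuous (f : R -> R) x (L r : R) : 0 < r ->
  (forall y, `|y - x| <= r -> `|f y - f x| <= L * `|y - x|) ->
  {for x, continuous f}.
Proof.
move=> r0 fL; apply/cvgrPdist_le => e e0.
have L0 : 0 < `|L| + 1 by rewrite ltr_wpDl.
apply: (@near_ballP _ _ _ (Num.min r (e / (`|L| + 1)))).
  by rewrite lt_min r0 divr_gt0.
move=> y; rewrite lt_min => /andP[/ltW yr /ltW ye].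
rewrite distrC (le_trans (fL _ yr)) //.
move: ye; rewrite ler_pdivlMr // => ye; apply: le_trans ye.
by rewrite mulrC ler_wpM2l // (le_trans (ler_norm _)) // lerDl.
Qed.

Lemma closed_form_continuous (P Q : R -> R -> R) s t : closed_form_at P Q s t ->
  {for s, continuous (P ^~ t)} /\ {for t, continuous (Q s)}.
Proof.
move=> [p [q [k /(_ 1 ltr01)[r r0 H]]]]; split.
  apply: (@lipschitz_continuous _ _ (`|p| + 1) _ r0) => y yr.
  have [] := H y t yr; first by rewrite subrr normr0 ltW.
  rewrite subrr normr0 mulr0 subr0 addr0 mul1r => h _.
  rewrite (_ : P y t - P s t = (P y t - P s t - p * (y - s)) + p * (y - s));
    last by ring.
  by rewrite (le_trans (ler_normD _ _)) // normrM mulrDl mul1r addrC lerD2l.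
apply: (@lipschitz_continuous _ _ (`|q| + 1) _ r0) => y yr.
have [|_] := H s y _ yr; first by rewrite subrr normr0 ltW.
rewrite subrr normr0 mulr0 subr0 add0r mul1r => h.
rewrite (_ : Q s y - Q s t = (Q s y - Q s t - q * (y - t)) + q * (y - t));
  last by ring.
by rewrite (le_trans (ler_normD _ _)) // normrM mulrDl mul1r addrC lerD2l.
Qed.

Lemma norm_polar_ln (x : R) t : 0 < x -> `|polar (ln x) t| = x%:C.
Proof. by move=> x0; rewrite norm_polar lnK. Qed.

(** Goursat's lemma on the logarithmic rectangle [[ln r, ln rho] x [0, 2 pi]]:
    the horizontal sides cancel by periodicity, so the mean of [Re v] is the
    same over the circles of radii [r] and [rho]; now let [r] tend to [0]. *)
Lemma mean_value_le v (rho B : R) : 0 < rho -> rho < 1 ->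
    (forall z, `|z| < 1 -> holo v z) ->
    (forall z, `|z| = rho%:C -> complex.Re (v z) <= B) ->
  complex.Re (v 0) <= B.
Proof.
move=> rho0 rho1 hv vB; rewrite leNgt; apply/negP => Bv.
pose e := (complex.Re (v 0) - B) / 2.
have e0 : 0 < e by rewrite divr_gt0 // subr_gt0.
have [|d vd] := @holo_approx _ v 0; first by apply: hv; rewrite normr0.
have [r r0 {}vd] := vd _ ltr01.
have [nd nd0 ndE] := ge0_realE (normr_ge0 d).
pose r1 := Num.min (Num.min rho (r / 2)) (e / (nd + 1)).
have nd1 : 0 < nd + 1 by rewrite ltr_wpDl.
have r10 : 0 < r1 by rewrite !lt_min rho0 (divr_gt0 r0) // (divr_gt0 e0).
have r1rho : r1 <= rho by rewrite !ge_min lexx.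
have near0 z : `|z| = r1%:C -> complex.Re (v 0) - e <= complex.Re (v z).
  move=> zr1; have := vd z; rewrite subr0 zr1 ltcR => h.
  have {}h : `|v z - v 0 - d * z| <= r1%:C.
    rewrite -[leRHS]mul1r; apply: h.
    by apply: le_lt_trans (_ : r / 2 < r); [rewrite !ge_min lexx orbT|lra].
  have : `|complex.Re (v z - v 0)| <= e.
    apply: norm_Re_le; rewrite (_ : v z - v 0 = (v z - v 0 - d * z) + d * z);
      last by ring.
    apply: le_trans (ler_normD _ _) _.
    rewrite (le_trans (lerD h (lexx _))) // normrM ndE zr1 -rmorphM -rmorphD lecR.
    have : r1 <= e / (nd + 1) by rewrite ge_min lexx orbT.
    by rewrite ler_pdivlMr //; lra.
  by rewrite raddfB /= ler_norml => /andP[]; lra.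
pose s1 := ln r1; pose s2 := ln rho.
pose P s t := complex.Im (v (polar s t)); pose Q s t := complex.Re (v (polar s t)).
have s12 : s1 <= s2 by rewrite ler_ln.
have pi20 : (0 : R) < pi *+ 2 by rewrite mulrn_wgt0 // pi_gt0.
have closed s t : s1 <= s <= s2 -> 0 <= t <= pi *+ 2 -> closed_form_at P Q s t.
  move=> /andP[_ ss2] _; apply: holo_closed_form; apply: hv.
  rewrite norm_polar ltcR (le_lt_trans _ rho1) //.
  by rewrite -[leRHS]lnK ?posrE // ler_expR.
have cf : continuous_form P Q s1 s2 0 (pi *+ 2).
  by split=> [t ht s hs|s hs t ht];
    have [] := closed_form_continuous (closed _ _ hs ht).
have := goursat s12 (ltW pi20) cf closed.
rewrite /rect_int (@eq_int_seg _ _ (fun=> 0)); last first.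
  by move=> s _; rewrite /P /polar cos0 sin0 cos2pi sin2pi subrr.
rewrite int_seg_cst // mul0r add0r => I0.
have : int_seg (fun t => Q s2 t - Q s1 t) 0 (pi *+ 2) <= - e * (pi *+ 2 - 0).
  rewrite -int_seg_cst ?(ltW pi20) //; apply: le_int_seg.
  - have [_ cQ] := cf.
    by apply: continuous_segB; apply: cQ; rewrite lexx ?s12.
  - exact: continuous_seg_cst.
  - move=> t _; have := near0 _ (norm_polar_ln t r10).
    have := vB _ (norm_polar_ln t rho0); rewrite /Q -/s1 -/s2 /e; lra.
by rewrite I0 subr0 mulNr oppr_ge0 leNgt mulr_gt0.
Qed.

(** The mean value inequality for [v] turned so that [v 0] is a nonnegative
    real. *)
Lemma circle_max v (rho B : R) : 0 < rho -> rho < 1 ->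
    (forall z, `|z| < 1 -> holo v z) ->
    (forall z, `|z| = rho%:C -> `|v z| <= B%:C) ->
  `|v 0| <= B%:C.
Proof.
move=> rho0 rho1 hv vB; have [v0|v0] := eqVneq (v 0) 0.
  rewrite v0 normr0; apply: le_trans (vB rho%:C _); first exact: normr_ge0.
  by rewrite ger0_norm // ler0c ltW.
pose c := `|v 0| / v 0.
have c1 : `|c| = 1 by rewrite normf_div normr_id divff // normr_eq0.
have [x x0 xE] := ge0_realE (normr_ge0 (v 0)).
have := @mean_value_le (fun z => c * v z) rho B rho0 rho1.
rewrite /c divfK // xE lecR; apply.
  by move=> z z1; apply: holoM; [exact: holo_cst|exact: hv].
move=> z zr; rewrite -xE -/c; apply: le_trans (ler_norm _) _; apply: norm_Re_le.
by rewrite normrM c1 mul1r; exact: vB.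
Qed.

(** [v] is bounded by [B] near the boundary of the disc, up to any [e > 0]. *)
Definition boundary_bound u (B : R) := forall e : R, 0 < e -> exists2 rho : R,
  rho < 1 & forall z, rho%:C < `|z| -> `|z| < 1 -> `|u z| <= (B + e)%:C.

Lemma blaschke_identity (a z : C) :
  `|1 + a^* * z| ^+ 2 - `|z + a| ^+ 2 = (1 - `|a| ^+ 2) * (1 - `|z| ^+ 2).
Proof. by rewrite !normCK !rmorphD !rmorphM !rmorph1 /= conjCK; ring. Qed.

(** If [|a| = al] and [|z| = r], let [x = |z + a|] and [y = |1 + a^* z|]: the
    image of [z] under [z |-> (z + a) / (1 + a^* z)] has modulus above [rho]. *)
Lemma moebius_escape (al rho x y : R) (r := 1 - (1 - rho ^+ 2) * (1 - al) / 8) :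
    0 <= al -> al < 1 -> 0 <= rho -> rho < 1 -> 0 <= x -> 0 <= y ->
    1 - al <= y -> y ^+ 2 - x ^+ 2 = (1 - al ^+ 2) * (1 - r ^+ 2) ->
  rho * y < x.
Proof.
move=> al0 al1 rho0 rho1 x0 y0 y1 xy.
rewrite -(@ltr_pXn2r _ 2) ?nnegrE ?mulr_ge0 // exprMn.
have d0 : 0 < 1 - al by rewrite subr_gt0.
have k0 : 0 < 1 - rho ^+ 2 by rewrite subr_gt0 expr_lt1.
set t := (1 - rho ^+ 2) * (1 - al) ^+ 2.
have t0 : 0 < t by rewrite mulr_gt0 // exprn_gt0.
have ty : t <= (1 - rho ^+ 2) * y ^+ 2.
  by rewrite ler_pM2l // ler_pXn2r ?nnegrE // ltW.
have r1 : 0 <= 1 - r by rewrite /r subKr !mulr_ge0 ?invr_ge0 // ltW.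
have r2 : 0 <= 1 + r <= 2.
  have : (1 - rho ^+ 2) * (1 - al) <= 1 * 1.
    by apply: ler_pM; rewrite ?(ltW k0) ?(ltW d0) // lerBlDr lerDl // sqr_ge0.
  move: r1; rewrite /r; set q := _ * (1 - al); lra.
have : (1 - al ^+ 2) * (1 - r ^+ 2) <= t / 2.
  have -> : t / 2 = (1 - al) * 2 * (2 * (1 - r)) by rewrite /t /r; field.
  have -> : (1 - al ^+ 2) * (1 - r ^+ 2) = (1 - al) * (1 + al) * ((1 + r) * (1 - r)).
    by ring.
  have [r2' r2''] := andP r2.
  apply: ler_pM.
  - by rewrite mulr_ge0 ?(ltW d0) // addr_ge0.
  - by rewrite mulr_ge0.
  - by rewrite ler_pM2l // -[leRHS](natrD _ 1 1) lerD2l ltW.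
  - by rewrite ler_wpM2r.
move: (_ * (1 - r ^+ 2)) xy ty t0 => q xy; rewrite mulrBl mul1r.
move: (rho ^+ 2 * _) => w; lra.
Qed.

(** The mean value inequality at [a], after moving [0] to [a] by the
    automorphism [z |-> (z + a) / (1 + a^* z)] of the disc. *)
Lemma disc_max v (B : R) : (forall z, `|z| < 1 -> holo v z) ->
  boundary_bound v B -> forall a, `|a| < 1 -> `|v a| <= B%:C.
Proof.
move=> hv vB a a1; have [al al0 alE] := ge0_realE (normr_ge0 a).
have al1 : al < 1 by move: a1; rewrite alE ltcR.
have [b b0 bE] := ge0_realE (normr_ge0 (v a)).
rewrite bE lecR; apply/ler_addgt0Pr => e e0.
have [rho' rho'1 {}vB] := vB e e0.
pose rho := Num.max rho' 0.
have rho0 : 0 <= rho by rewrite le_max lexx orbT.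
have rho1 : rho < 1 by rewrite gt_max rho'1 ltr01.
have {}vB z : rho%:C < `|z| -> `|z| < 1 -> `|v z| <= (B + e)%:C.
  by move=> h; apply: vB; apply: le_lt_trans h; rewrite lecR le_max lexx.
pose m z := (z + a) / (1 + a^* * z).
have den z : `|z| < 1 -> 0 < `|1 + a^* * z|.
  move=> z1; rewrite normr_gt0; apply/eqP => den0.
  have : `|a^* * z| < 1.
    rewrite normrM norm_conjC; apply: le_lt_trans z1.
    by rewrite ler_piMl // ltW.
  by rewrite (_ : a^* * z = -1) ?normrN1 ?ltxx //; apply/eqP; rewrite -addr_eq0 addrC den0.
have m1 z : `|z| < 1 -> `|m z| < 1.
  move=> z1; rewrite normf_div ltr_pdivrMr ?den // mul1r.
  rewrite -(@ltr_pXn2r _ 2) // ?nnegrE ?normr_ge0 //.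
  rewrite -subr_gt0 blaschke_identity mulr_gt0 // subr_gt0 expr_lt1 //.
have hm z : `|z| < 1 -> holo (fun z => v (m z)) z.
  move=> z1; apply: holo_comp; last exact/hv/m1.
  apply: holoM; first by apply: holoD; [exact: holo_id|exact: holo_cst].
  apply: holoV; last by rewrite -normr_gt0 den.
  apply: holoD; first exact: holo_cst.
  by apply: holoM; [exact: holo_cst|exact: holo_id].
(* Points of modulus [r] are mapped by [m] outside the disc of radius [rho]. *)
pose r := 1 - (1 - rho ^+ 2) * (1 - al) / 8.
have q0 : 0 < (1 - rho ^+ 2) * (1 - al).
  by rewrite mulr_gt0 ?subr_gt0 // expr_lt1.
have q1 : (1 - rho ^+ 2) * (1 - al) <= 1.
  rewrite mulr_ile1 ?subr_ge0 ?lerBlDr ?lerDl ?sqr_ge0 ?(ltW al1) //.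
  by rewrite expr_le1 // ltW.
have r0 : 0 < r by rewrite /r; lra.
have r1 : r < 1 by rewrite /r; lra.
have m_out z : `|z| = r%:C -> rho%:C < `|m z|.
  move=> zr; have z1 : `|z| < 1 by rewrite zr ltcR.
  rewrite normf_div ltr_pdivlMr ?den //.
  have := blaschke_identity a z; rewrite zr alE.
  have [x x0 ->] := ge0_realE (normr_ge0 (z + a)).
  have y1 : 1 - al%:C <= `|1 + a^* * z|.
    apply: le_trans (lerB_normD _ _); rewrite normr1 lerD2l lerN2.
    by rewrite normrM norm_conjC alE ler_piMr ?ler0c // ltW.
  move: y1; have [y y0 ->] := ge0_realE (normr_ge0 (1 + a^* * z)).
  rewrite -(rmorph1 (real_complex R)) -!rmorphXn -!rmorphB -!rmorphM ltcR lecR.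
  move=> y1 /complexI xy.
  exact: (moebius_escape al0 al1 rho0 rho1 x0 y0 y1 xy).
have := circle_max r0 r1 hm; rewrite {2}/m mulr0 add0r addr0 divr1 bE => h.
rewrite -lecR; apply: h => z zr; apply: vB; first exact: m_out.
by apply: m1; rewrite zr ltcR.
Qed.

End MaximumPrinciple.

(** * The Schwarz-Pick inequality *)

Section SchwarzPick.
Variable R : realType.
Local Notation C := R[i].
Local Notation "x %:C" := (real_complex R x).
Implicit Types (z a : C) (v u g h : C -> C).

Lemma blaschke_identityB a z :
  `|1 - a^* * z| ^+ 2 - `|z - a| ^+ 2 = (1 - `|a| ^+ 2) * (1 - `|z| ^+ 2).
Proof. by rewrite -(normrN a) -blaschke_identity rmorphN mulNr. Qed.

Lemma le1_of_bounded_powers (x K : R) : (forall N, x ^+ N <= K) -> x <= 1.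
Proof.
move=> xK; rewrite leNgt; apply/negP => x1.
have d0 : 0 < x - 1 by rewrite subr_gt0.
have bernoulli N : 1 + N%:R * (x - 1) <= x ^+ N.
  elim: N => [|N IH]; first by rewrite mul0r addr0 expr0.
  have : x * (1 + N%:R * (x - 1)) <= x * x ^+ N by rewrite ler_pM2l //; lra.
  have : 0 <= N%:R * (x - 1) * (x - 1) by rewrite !mulr_ge0 ?(ltW d0).
  rewrite exprS -natr1; lra.
have := archi_boundP (divr_ge0 (normr_ge0 K) (ltW d0)); set N := Num.bound _.
rewrite ltr_pdivrMr // => KN; have := bernoulli N; have := xK N.
have := ler_norm K; lra.
Qed.

(** The maximum principle for a bounded function with finitely many isolated
    singularities: multiplying a high power of [u] by [(z - a) ^ 2] makes it
    differentiable at [a], and this factor is negligible once the root is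
    taken. *)
Lemma punctured_disc_max (S : seq C) u (B : R) : 0 <= B ->
    (forall z, `|z| < 1 -> z \notin S -> holo u z) ->
    (exists M : R, forall z, `|z| < 1 -> `|u z| <= M%:C) ->
    boundary_bound u B ->
  forall z, `|z| < 1 -> z \notin S -> `|u z| <= B%:C.
Proof.
elim: S u B => [|a S IH] u B B0 hu [M uM] uB z z1.
  by move=> _; apply: disc_max => // y y1; exact: hu.
rewrite in_cons negb_or => /andP[za zS].
have [x x0 xE] := ge0_realE (normr_ge0 (u z)).
have [y y0 yE] := ge0_realE (normr_ge0 (z - a)).
have [al al0 alE] := ge0_realE (normr_ge0 a).
have M0 : 0 <= M.
  by rewrite -ler0c (le_trans (normr_ge0 (u z))) //; exact: uM.
have ygt0 : 0 < y by rewrite -ltcR -yE normr_gt0 subr_eq0.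
rewrite xE lecR; apply/ler_addgt0Pr => e e0.
have Be : 0 < B + e by rewrite ltr_wpDl.
rewrite -[leRHS]mul1r -ler_pdivrMr //.
have za_le w : `|w| < 1 -> `|w - a| <= (1 + al)%:C.
  move=> w1; apply: le_trans (ler_normB _ _) _.
  by rewrite alE rmorphD rmorph1 lerD2r ltW.
have za2 w : `|w| < 1 -> `|w - a| ^+ 2 <= ((1 + al) ^+ 2)%:C.
  by move=> w1; rewrite rmorphXn ler_pXn2r ?nnegrE ?normr_ge0 ?ler0c ?addr_ge0 // za_le.
pose K := (1 + al) ^+ 2.
have K0 : 0 <= K by rewrite sqr_ge0.
apply: (@le1_of_bounded_powers _ (1 + K / y ^+ 2)) => -[|N].
  by rewrite expr0 lerDl divr_ge0 // sqr_ge0.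
apply: (@le_trans _ _ (K / y ^+ 2)); last by rewrite lerDr.
rewrite expr_div_n ler_pdivrMr ?exprn_gt0 // mulrAC ler_pdivlMr ?exprn_gt0 //.
rewrite -lecR rmorphM !rmorphXn /= -xE -yE -!normrX -normrM.
apply: (IH (fun z => u z ^+ N.+1 * (z - a) ^+ 2)); [| | | |exact: z1|exact: zS].
- by rewrite mulr_ge0 // exprn_ge0 // ltW.
- move=> w w1 wS; have [wa|wa] := eqVneq w a.
    rewrite wa alE -(rmorph1 (real_complex R)) ltcR in w1 *.
    apply: (@holo_quadratic _ _ _ (M ^+ N.+1) (1 - al)); first by rewrite subr_gt0.
    move=> b ba; rewrite subrr expr0n mulr0 subr0 normrM !normrX rmorphXn.
    rewrite ler_wpM2r ?exprn_ge0 ?normr_ge0 //.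
    rewrite ler_pXn2r ?nnegrE ?normr_ge0 ?ler0c // uM //.
    rewrite -(subrK a b); apply: le_lt_trans (ler_normD _ _) _.
    by rewrite alE -ltrBrDr -(rmorph1 (real_complex R)) -rmorphB.
  have hw : holo u w by apply: hu => //; rewrite in_cons negb_or wa.
  apply: holoM; first exact: holoX.
  by apply: holoX; apply: holoB; [exact: holo_id|exact: holo_cst].
- exists (M ^+ N.+1 * K) => w w1; rewrite normrM !normrX rmorphM rmorphXn.
  by rewrite ler_pM ?exprn_ge0 ?normr_ge0 ?za2 // ler_pXn2r ?nnegrE ?normr_ge0 ?ler0c ?uM.
- move=> e1 e10; have [rho rho1 uBe] := uB e e0; exists rho => // w w1 w2.
  rewrite normrM !normrX; apply: (@le_trans _ _ (K * (B + e) ^+ N.+1)%:C).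
    rewrite mulrC rmorphM ler_pM ?exprn_ge0 ?normr_ge0 ?za2 //.
    by rewrite rmorphXn ler_pXn2r ?nnegrE ?normr_ge0 ?ler0c ?(ltW Be) ?uBe.
  by rewrite lecR lerDl ltW.
Qed.

(** A function holomorphic at [a] has bounded difference quotients near [a]. *)
Lemma holo_lipschitz g a : holo g a -> exists K r : R, [/\ 0 <= K, 0 < r &
  forall z, `|z - a| < r%:C -> `|g z - g a| <= K%:C * `|z - a|].
Proof.
move=> /holo_approx[d /(_ 1 ltr01)[r r0 gd]].
have [nd nd0 ndE] := ge0_realE (normr_ge0 d).
exists (1 + nd), r; split => // [|z za]; first exact: addr_ge0.
rewrite (_ : g z - g a = (g z - g a - d * (z - a)) + d * (z - a)); last by ring.
apply: le_trans (ler_normD _ _) _.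
by rewrite normrM ndE rmorphD mulrDl lerD2r gd.
Qed.

(** The value of [g z / z] at [0] is [0], by division by zero. *)
Lemma schwarz g : (forall z, `|z| < 1 -> holo g z) -> g 0 = 0 ->
    (forall z, `|z| < 1 -> `|g z| <= 1) ->
  forall z, `|z| < 1 -> `|g z / z| <= 1.
Proof.
move=> hg g0 g1 z z1; have [->|z0] := eqVneq z 0.
  by rewrite invr0 mulr0 normr0.
rewrite -(rmorph1 (real_complex R)).
apply: (@punctured_disc_max [:: 0] (fun z => g z / z)); [exact: ler01| | | |exact: z1|].
- move=> w w1; rewrite inE => w0; apply: holoM; first exact: hg.
  by apply: holoV => //; exact: holo_id.
- have [|K [r [K0 r0 gK]]] := @holo_lipschitz g 0; first by apply: hg; rewrite normr0.
  exists (K + r^-1) => w w1; have [->|w0] := eqVneq w 0.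
    by rewrite invr0 mulr0 normr0 ler0c addr_ge0 // invr_ge0 ltW.
  rewrite normf_div ler_pdivrMr ?normr_gt0 //.
  have rR : r%:C \is Num.real by rewrite ger0_real // ler0c ltW.
  have [wr|rw] := real_ltP (normr_real w) rR.
  + move: (gK w); rewrite subr0 g0 subr0 => /(_ wr) h; apply: le_trans h _.
    by rewrite ler_wpM2r ?normr_ge0 // lecR lerDl invr_ge0 ltW.
  + apply: le_trans (g1 w w1) _.
    apply: (@le_trans _ _ ((r^-1)%:C * r%:C)).
      by rewrite -rmorphM mulVf ?rmorph1 // gt_eqF.
    by rewrite ler_pM ?ler0c ?invr_ge0 ?(ltW r0) // lecR lerDr.
- move=> e e0; exists (1 + e)^-1 => [|w w1 w2]; first by rewrite invf_lt1; lra.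
  have e10 : 0 < 1 + e by lra.
  have w0 : 0 < `|w| by apply: le_lt_trans w1; rewrite ler0c invr_ge0 ltW.
  rewrite normf_div ler_pdivrMr //; apply: le_trans (g1 w w2) _.
  rewrite fmorphV in w1; rewrite mulrC -ler_pdivrMr ?ltcR //.
  by rewrite mul1r ltW.
- by rewrite inE.
Qed.

Lemma le_of_scaled_le (x y k : R) : 0 <= k ->
  (forall s, 0 < s < 1 -> x - y <= s * k) -> x <= y.
Proof.
move=> k0 H; apply/ler_addgt0Pr => e e0.
have k1 : 0 < k + 1 by lra.
pose s := Num.min (1 / 2) (e / (k + 1)).
have s0 : 0 < s by rewrite lt_min !divr_gt0.
have s1 : s < 1 by apply: le_lt_trans (_ : 1 / 2 < 1); [rewrite ge_min lexx|lra].
have se : s <= e / (k + 1) by rewrite ge_min lexx orbT.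
have := H s; rewrite s0 s1 => /(_ isT).
have : s * k <= s * (k + 1) by rewrite ler_pM2l //; lra.
move: se; rewrite ler_pdivlMr //; lra.
Qed.

(** With [al = |a|], [om = |w|], [X = |1 - a^* w|] and [Y = |w - a|]: the ratio
    [X / Y] is at most [1 + e] as soon as [om] is close enough to [1]. *)
Lemma blaschke_boundary_ratio (al om e X Y : R) :
    0 <= al -> al < 1 -> 0 <= om -> om < 1 -> 0 < e -> 0 <= X ->
    1 - Num.min 1 e * (1 - al) ^+ 2 / 8 < om -> om - al <= Y ->
    X ^+ 2 - Y ^+ 2 = (1 - al ^+ 2) * (1 - om ^+ 2) ->
  0 < Y /\ X <= (1 + e) * Y.
Proof.
move=> al0 al1 om0 om1 e0 X0; set m := Num.min 1 e; set d := _ / 8 => dom omY XY.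
have m0 : 0 < m by rewrite lt_min ltr01.
have m1 : m <= 1 by rewrite ge_min lexx.
have me : m <= e by rewrite ge_min lexx orbT.
have d1 : 0 < 1 - al by rewrite subr_gt0.
have dl : d <= (1 - al) / 2.
  have : m * ((1 - al) * (1 - al)) <= 1 * (1 * (1 - al)).
    apply: ler_pM; rewrite ?mulr_ge0 ?(ltW m0) ?(ltW d1) //.
    by rewrite ler_wpM2r ?(ltW d1) // lerBlDr lerDl.
  by rewrite /d expr2; move: (m * _) d1 => q; lra.
have Yle : (1 - al) / 2 <= Y by move: dom omY dl; lra.
have Ygt0 : 0 < Y by apply: lt_le_trans Yle; rewrite divr_gt0.
split=> //; rewrite -(@ler_pXn2r _ 2) ?nnegrE ?mulr_ge0 ?addr_ge0 ?(ltW e0) ?(ltW Ygt0) //.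
rewrite exprMn.
have small : (1 - al ^+ 2) * (1 - om ^+ 2) <= 1 * (2 * d).
  apply: ler_pM; rewrite ?subr_ge0 ?expr_le1 ?(ltW om1) ?(ltW al1) //.
    by rewrite lerBlDr lerDl sqr_ge0.
  rewrite (_ : 1 - om ^+ 2 = (1 + om) * (1 - om)); last by ring.
  apply: ler_pM.
  - by rewrite addr_ge0.
  - by rewrite subr_ge0 ltW.
  - by rewrite -[leRHS](natrD _ 1 1) lerD2l ltW.
  - by move: dom; clear; lra.
have eY : 2 * d <= e * Y ^+ 2.
  apply: (@le_trans _ _ (m * ((1 - al) / 2) ^+ 2)).
    by rewrite /d le_eqVlt; apply/orP; left; apply/eqP; field.
  apply: ler_pM; rewrite ?sqr_ge0 ?(ltW m0) //.
  by rewrite ler_pXn2r ?nnegrE ?divr_ge0 ?(ltW d1) ?(ltW Ygt0).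
have e1 : 0 <= e * Y ^+ 2 by rewrite mulr_ge0 ?sqr_ge0 // ltW.
have e2 : 0 <= e ^+ 2 * Y ^+ 2 by rewrite mulr_ge0 ?sqr_ge0.
have -> : (1 + e) ^+ 2 * Y ^+ 2 = Y ^+ 2 + 2 * (e * Y ^+ 2) + e ^+ 2 * Y ^+ 2.
  by ring.
move: XY small eY e1 e2.
move: (X ^+ 2) (Y ^+ 2) (e ^+ 2 * Y ^+ 2) (e * Y ^+ 2) => x y v w.
by clear; lra.
Qed.

(** The maximum principle for [(h z - h a) / (1 - (h a)^* h z)] divided by
    [(z - a) / (1 - a^* z)], with possible singularities at [0] and [a]. The
    bound [t < 1] keeps the first denominator away from zero. *)
Lemma schwarz_pick_strict h (t : R) (a z : C) : 0 < t < 1 ->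
    (forall z, `|z| < 1 -> z != 0 -> holo h z) ->
    (forall z, `|z| < 1 -> `|h z| <= t%:C) ->
    `|a| < 1 -> a != 0 -> `|z| < 1 -> z != 0 -> z != a ->
  `|h z - h a| * `|1 - a^* * z| <= `|1 - (h a)^* * h z| * `|z - a|.
Proof.
move=> /andP[t0 t1] hh ht a1 a0 z1 z0 za.
have [al al0 alE] := ge0_realE (normr_ge0 a).
have al1 : al < 1 by move: a1; rewrite alE ltcR.
have c0 : 0 < 1 - t by lra.
have den w : `|w| < 1 -> (1 - t)%:C <= `|1 - (h a)^* * h w|.
  move=> w1; apply: le_trans (lerB_normD _ _); rewrite normr1 normrN rmorphB.
  rewrite rmorph1 lerD2l lerN2 normrM norm_conjC.
  apply: (@le_trans _ _ (t%:C * 1)); last by rewrite mulr1.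
  rewrite ler_pM ?normr_ge0 ?ht // (le_trans (ht _ _)) //.
  by rewrite -(rmorph1 (real_complex R)) lecR ltW.
have den0 w : `|w| < 1 -> 0 < `|1 - (h a)^* * h w|.
  by move=> w1; apply: lt_le_trans (den w w1); rewrite ltcR.
have num2 w : `|w| < 1 -> `|1 - a^* * w| <= 2.
  move=> w1; apply: le_trans (ler_normB _ _) _; rewrite normr1 normrM norm_conjC.
  by rewrite lerD2l mulr_ile1 ?normr_ge0 // ltW.
pose u w := (h w - h a) / (w - a) * ((1 - a^* * w) / (1 - (h a)^* * h w)).
suff : `|u z| <= 1%:C.
  rewrite rmorph1 /u !normrM !normfV mulrACA -invfM ler_pdivrMr ?mul1r.
    by rewrite [leRHS]mulrC.
  by rewrite mulr_gt0 ?den0 // normr_gt0 subr_eq0.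
apply: (@punctured_disc_max [:: 0; a] u); [exact: ler01| | | |exact: z1|].
- move=> w w1; rewrite !inE negb_or => /andP[w0 wa].
  apply: holoM; apply: holoM.
  + by apply: holoB; [exact: hh|exact: holo_cst].
  + by apply: holoV; [apply: holoB; [exact: holo_id|exact: holo_cst]|rewrite subr_eq0].
  + apply: holoB; first exact: holo_cst.
    by apply: holoM; [exact: holo_cst|exact: holo_id].
  + apply: holoV; last by rewrite -normr_gt0 den0.
    apply: holoB; first exact: holo_cst.
    by apply: holoM; [exact: holo_cst|exact: hh].
- have [K [r [K0 r0 hK]]] := @holo_lipschitz h a (hh _ a1 a0).
  exists ((K + 2 / r) * (2 / (1 - t))) => w w1.
  rewrite /u normrM rmorphM ler_pM ?normr_ge0 //; last first.
    rewrite normf_div ler_pdivrMr ?den0 // rmorphM rmorphV /= ?unitfE ?gt_eqF //.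
    rewrite mulrAC ler_pdivlMr ?ltcR //.
    by rewrite ler_pM ?normr_ge0 ?ler0c ?(ltW c0) ?den // rmorph_nat num2.
  have [->|wa] := eqVneq w a.
    by rewrite !subrr invr0 mulr0 normr0 ler0c addr_ge0 // divr_ge0 // ltW.
  have wa0 : 0 < `|w - a| by rewrite normr_gt0 subr_eq0.
  rewrite normf_div ler_pdivrMr //.
  have rR : r%:C \is Num.real by rewrite ger0_real // ler0c ltW.
  have [wr|rw] := real_ltP (normr_real (w - a)) rR.
  + apply: le_trans (hK _ wr) _.
    by rewrite ler_wpM2r ?normr_ge0 // lecR lerDl divr_ge0 // ltW.
  + apply: (@le_trans _ _ ((2 / r)%:C * r%:C)).
      rewrite -rmorphM divfK ?gt_eqF // rmorph_nat -[leRHS](natrD _ 1 1).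
      apply: le_trans (ler_normB _ _) _.
      by rewrite lerD // (le_trans (ht _ _)) // -(rmorph1 (real_complex R)) lecR ltW.
    by rewrite ler_pM ?ler0c ?divr_ge0 ?(ltW r0) // lecR lerDr.
- (* [|1 - a^* w| / |w - a|] tends to 1 at the boundary *)
  move=> e e0; exists (1 - Num.min 1 e * (1 - al) ^+ 2 / 8) => [|w dw w1].
    rewrite ltrBlDr ltrDl !mulr_gt0 ?exprn_gt0 ?subr_gt0 ?invr_gt0 //.
    by rewrite lt_min ltr01.
  have [om om0 omE] := ge0_realE (normr_ge0 w).
  rewrite omE ltcR in dw.
  have om1 : om < 1 by rewrite -ltcR -omE rmorph1.
  have [X X0 XE] := ge0_realE (normr_ge0 (1 - a^* * w)).
  have [Y Y0 YE] := ge0_realE (normr_ge0 (w - a)).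
  have [N N0 NE] := ge0_realE (normr_ge0 (h w - h a)).
  have [D D0 DE] := ge0_realE (normr_ge0 (1 - (h a)^* * h w)).
  have Dgt0 : 0 < D by rewrite -ltcR -DE den0.
  have omY : om - al <= Y.
    by rewrite -lecR rmorphB /= -omE -alE -YE; apply: lerB_dist.
  have NleD : N <= D.
    rewrite -(@ler_pXn2r _ 2) ?nnegrE // -lecR !rmorphXn /= -NE -DE -subr_ge0.
    rewrite blaschke_identityB mulr_ge0 // subr_ge0 expr_le1 ?normr_ge0 //.
      by rewrite (le_trans (ht _ _)) // -(rmorph1 (real_complex R)) lecR ltW.
    by rewrite (le_trans (ht _ _)) // -(rmorph1 (real_complex R)) lecR ltW.
  have XY : X ^+ 2 - Y ^+ 2 = (1 - al ^+ 2) * (1 - om ^+ 2).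
    apply: complexI; have := blaschke_identityB a w; rewrite XE YE alE omE.
    by rewrite rmorphM !rmorphB !rmorphXn rmorph1.
  have [Ygt0 XleY] := blaschke_boundary_ratio al0 al1 om0 om1 e0 X0 dw omY XY.
  rewrite /u normrM !normf_div NE YE XE DE -!fmorphV -!rmorphM lecR.
  rewrite mulrACA -invfM ler_pdivrMr ?mulr_gt0 //.
  apply: le_trans (ler_pM N0 X0 NleD XleY) _.
  by rewrite le_eqVlt; apply/orP; left; apply/eqP; ring.
- by rewrite !inE negb_or z0.
Qed.

(** The Schwarz-Pick inequality, allowing for a singularity at [0]; it follows
    by applying [schwarz_pick_strict] to [(1 - s) h] and letting [s] tend to
    [0]. *)
Lemma schwarz_pick h (a z : C) :
    (forall z, `|z| < 1 -> z != 0 -> holo h z) ->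
    (forall z, `|z| < 1 -> `|h z| <= 1) ->
    `|a| < 1 -> a != 0 -> `|z| < 1 -> z != 0 ->
  `|h z - h a| * `|1 - a^* * z| <= `|1 - (h a)^* * h z| * `|z - a|.
Proof.
move=> hh h1 a1 a0 z1 z0; have [->|za] := eqVneq z a.
  by rewrite !subrr normr0 mul0r mulr0.
have [x x0 xE] := ge0_realE (normr_ge0 (h z - h a)).
have [y y0 yE] := ge0_realE (normr_ge0 (1 - a^* * z)).
have [p p0 pE] := ge0_realE (normr_ge0 (1 - (h a)^* * h z)).
have [q q0 qE] := ge0_realE (normr_ge0 (z - a)).
rewrite xE yE pE qE -!rmorphM lecR.
apply: (@le_of_scaled_le _ _ (x * y + 2 * q)) => [|s /andP[s0 s1]].
  by rewrite addr_ge0 ?mulr_ge0.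
have [t tE] : exists t, t = 1 - s by exists (1 - s).
have t01 : 0 < t < 1 by rewrite tE subr_gt0 s1 ltrBlDr ltrDl.
have [t0 t1] := andP t01.
have := @schwarz_pick_strict (fun z => t%:C * h z) t a z t01.
move=> /(_ _ _ a1 a0 z1 z0 za).
rewrite -mulrBr normrM xE yE qE ger0_norm ?ler0c ?(ltW t0) //.
have : `|1 - (t%:C * h a)^* * (t%:C * h z)| <= (p + 2 * s)%:C.
  rewrite (_ : 1 - _ = (1 - (h a)^* * h z) + (1 - t ^+ 2)%:C * ((h a)^* * h z)); last first.
    rewrite rmorphM /= conj_Creal ?ger0_real ?ler0c ?(ltW t0) //.
    by rewrite rmorphB rmorph1 rmorphXn /=; ring.
  apply: le_trans (ler_normD _ _) _; rewrite pE [leRHS]rmorphD /= lerD2l normrM.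
  have k0 : 0 <= 1 - t ^+ 2 by rewrite subr_ge0 expr_le1 // ltW.
  rewrite ger0_norm ?ler0c //.
  apply: (@le_trans _ _ ((1 - t ^+ 2)%:C * 1)).
    rewrite ler_wpM2l ?ler0c // normrM norm_conjC.
    by rewrite mulr_ile1 ?normr_ge0 ?h1.
  rewrite mulr1 lecR tE -subr_ge0.
  by rewrite (_ : 2 * s - _ = s ^+ 2) ?sqr_ge0 //; ring.
move=> P1 H; have {H} : t%:C * x%:C * y%:C <= (p + 2 * s)%:C * q%:C.
  apply: le_trans (H _ _) _ => [w w1 w0|w w1|].
  - by apply: holoM; [exact: holo_cst|exact: hh].
  - rewrite normrM ger0_norm ?ler0c ?(ltW t0) // ler_piMr ?ler0c ?h1 //.
    exact: ltW.
  - by rewrite ler_wpM2r // ler0c.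
rewrite -!rmorphM lecR tE => H.
have : s * q <= 1 * q by rewrite ler_wpM2r // ltW.
lra.
Qed.

End SchwarzPick.

(** * Characteristic polynomials and the spectral ball *)

Section CharPoly.
Variable R : realType.
Local Notation C := R[i].
Local Notation "x %:C" := (real_complex R x).

(** Coefficientwise complex differentiability. *)
Definition holo_poly (p : C -> {poly C}) z := forall k, holo (fun x => (p x)`_k) z.

Lemma holo_poly_cst p z : holo_poly (fun=> p) z.
Proof. by move=> k; exact: holo_cst. Qed.

Lemma holo_polyM p q z : holo_poly p z -> holo_poly q z ->
  holo_poly (fun x => p x * q x) z.
Proof.
move=> hp hq k; under [X in holo X]eq_fun do rewrite coefM.
by apply: holo_sum => i _; apply: holoM.
Qed.

Lemma holo_poly_prod (I : Type) (r : seq I) (F : I -> C -> {poly C}) z :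
  (forall i, holo_poly (F i) z) -> holo_poly (fun x => \prod_(i <- r) F i x) z.
Proof.
move=> hF; elim: r => [|i r IH].
  by under [X in holo_poly X]eq_fun do rewrite big_nil; exact: holo_poly_cst.
under [X in holo_poly X]eq_fun do rewrite big_cons.
exact: holo_polyM.
Qed.

Lemma holo_poly_sum (I : Type) (r : seq I) (F : I -> C -> {poly C}) z :
  (forall i, holo_poly (F i) z) -> holo_poly (fun x => \sum_(i <- r) F i x) z.
Proof.
move=> hF k; under [X in holo X]eq_fun do rewrite coef_sum.
by apply: holo_sum => i _; exact: hF.
Qed.

Lemma holo_char_poly n (F : C -> 'M[C]_n) z :
  derivable (F : C^o -> 'M[C]_n) z 1 -> holo_poly (fun x => char_poly (F x)) z.
Proof.
move=> /derivable1_diffP dF.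
have entry i j : holo (fun x => F x i j) z.
  exact: (differentiable_comp dF (differentiable_coord _ i j)).
apply: holo_poly_sum => s; apply: holo_polyM; first exact: holo_poly_cst.
apply: holo_poly_prod => i k.
under [X in holo X]eq_fun do rewrite !mxE coefB coefC.
apply: holoB; first exact: holo_cst.
by case: (k == 0%N); [exact: entry|exact: holo_cst].
Qed.

Lemma char_poly_roots n (W : 'M[C]_n) :
  exists rs : seq C, char_poly W = \prod_(r <- rs) ('X - r%:P) /\ size rs = n.
Proof.
have [rs rsE] := closed_field_poly_normal (char_poly W).
move: rsE; rewrite (monicP (char_poly_monic W)) scale1r => rsE; exists rs; split=> //.
by have := size_char_poly W; rewrite rsE size_prod_XsubC => -[].
Qed.

Lemma eigenvalue_rootsE n (W : 'M[C]_n) rs a :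
  char_poly W = \prod_(r <- rs) ('X - r%:P) -> eigenvalue W a = (a \in rs).
Proof. by move=> rsE; rewrite eigenvalue_root_char rsE root_prod_XsubC. Qed.

Lemma seq_norm_bounded (rs : seq C) (B : R) :
  (forall a, a \in rs -> `|a| < B%:C) ->
  exists2 M, M < B & forall a, a \in rs -> complex.Re `|a| <= M.
Proof.
elim: rs => [_|b rs IH h]; first by exists (B - 1) => //; rewrite ltrBlDr ltrDl.
have [|M MB Mrs] := IH; first by move=> a ars; apply: h; rewrite in_cons ars orbT.
exists (Num.max M (complex.Re `|b|)) => [|a].
  by rewrite gt_max MB -ltcR; exact: h (mem_head _ _).
rewrite in_cons le_max => /orP[/eqP -> |/Mrs ->//]; by rewrite lexx orbT.
Qed.

Lemma spectral_ballP n (W : 'M[C]_n) :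
  spectral_ball W <-> (forall a, eigenvalue W a -> `|a| < 1).
Proof.
have [rs [rsE _]] := char_poly_roots W.
have eig a := eigenvalue_rootsE a rsE.
rewrite /spectral_ball /spectral_radius /=; set A := (X in sup X).
split=> [supA a aW|lt1].
  have [B hB] : exists B : R, forall a, a \in rs -> `|a| < B%:C.
    elim: (rs) => [|b l [B hB]]; first by exists 0.
    have [x x0 xE] := ge0_realE (normr_ge0 b).
    exists (Num.max B (x + 1)) => c; rewrite in_cons => /orP[/eqP ->|/hB hc].
      by rewrite xE ltcR lt_max ltrDl ltr01 orbT.
    by apply: lt_le_trans hc _; rewrite lecR le_max lexx.
  have [M _ Mrs] := seq_norm_bounded hB.
  have : complex.Re `|a| <= sup A.
    apply: ub_le_sup; last by exists a.
    by exists M => _ [b bW <-]; apply: Mrs; rewrite -eig.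
  have [x x0 ->] := ge0_realE (normr_ge0 a) => /= xA.
  by rewrite -(rmorph1 (real_complex R)) ltcR (le_lt_trans xA).
have [|M M1 Mrs] := @seq_norm_bounded rs 1.
  by move=> a ars; rewrite rmorph1; apply: lt1; rewrite eig.
have [A0|/set0P A0] := eqVneq A set0; first by rewrite A0 sup0.
apply: le_lt_trans M1; apply: ge_sup => //.
by move=> _ [b bW <-]; apply: Mrs; rewrite -eig.
Qed.

(** On the unit circle [w / (w - r)] has real part above [1 / 2] when
    [|r| < 1]; summing over the [n] roots [r] of [p], [w p'(w) / p(w)]
    has real part above [n / 2], that is, it is closer to [n] than to [0]. *)
Lemma circle_deriv_bound (rs : seq C) (w : C) (p := \prod_(r <- rs) ('X - r%:P)) :
    (0 < size rs)%N -> (forall r, r \in rs -> `|r| < 1) -> `|w| = 1 ->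
  `|(size rs)%:R * p.[w] - w * p^`().[w]| < `|p^`().[w]|.
Proof.
move=> rs0 rs1 w1.
have w_neq r : r \in rs -> w - r != 0.
  move=> /rs1 r1; rewrite subr_eq0; apply/eqP => wr.
  by rewrite -wr w1 ltxx in r1.
have pw0 : p.[w] != 0.
  rewrite /p horner_prod prodf_seq_neq0; apply/allP => r /w_neq.
  by rewrite !hornerE.
pose c r := w / (w - r); pose S := \sum_(r <- rs) c r.
have wp' : w * p^`().[w] = p.[w] * S.
  rewrite /p /S; elim: (rs) w_neq => [|r l IH] hl.
    by rewrite !big_nil derivC horner0 !mulr0.
  rewrite !big_cons derivM !hornerE derivXsubC hornerE mul1r.
  have hr := hl r (mem_head _ _).
  have {}IH := IH (fun b bl => hl b (@mem_behead _ (r :: l) b bl)).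
  rewrite mulrDr [w * ((w - r) * _)]mulrCA IH /c; by field.
have cc r : r \in rs -> 0 < c r + (c r)^* - 1.
  move=> rrs; have -> : c r + (c r)^* - 1 = `|c r| ^+ 2 - `|c r - 1| ^+ 2.
    by rewrite !normCK rmorphB rmorph1; ring.
  have wr0 := w_neq r rrs.
  have -> : c r - 1 = r / (w - r) by rewrite /c; field.
  rewrite subr_gt0 ltr_pXn2r ?nnegrE ?normr_ge0 // !normf_div w1.
  by rewrite ltr_pM2r ?rs1 // invr_gt0 normr_gt0.
have SS : 0 < S + S^* - (size rs)%:R.
  have -> : S + S^* - (size rs)%:R = \sum_(r <- rs) (c r + (c r)^* - 1).
    by rewrite !big_split /= rmorph_sum sumrN big_const_seq count_predT iter_addr_0.
  case: (rs) rs0 cc => // r l _ cc; rewrite big_cons ltr_pwDl ?cc ?mem_head //.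
  rewrite big_seq_cond sumr_ge0 // => b; rewrite andbT => bl.
  by rewrite ltW // cc // in_cons bl orbT.
have n0 : 0 < (size rs)%:R :> C by rewrite ltr0n.
have nS : `|(size rs)%:R - S| < `|S|.
  rewrite -(@ltr_pXn2r _ 2) ?nnegrE ?normr_ge0 // -subr_gt0.
  have -> : `|S| ^+ 2 - `|(size rs)%:R - S| ^+ 2
      = (size rs)%:R * (S + S^* - (size rs)%:R).
    by rewrite !normCK rmorphB rmorph_nat; ring.
  exact: mulr_gt0.
have -> : `|p^`().[w]| = `|w * p^`().[w]| by rewrite normrM w1 mul1r.
by rewrite wp' mulrC -mulrBr !normrM ltr_pM2l // normr_gt0.
Qed.

End CharPoly.

(** * The rational function f and the companion matrices *)

Section RationalFunction.
Variable R : realType.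
Local Notation C := R[i].
Local Notation "x %:C" := (real_complex R x).

(** Numerator and denominator of [z |-> f(z; W)] in terms of the characteristic
    polynomial [p] of [W]. *)
Definition num_poly n (p : {poly C}) := \poly_(k < n) (k.+1%:R * p`_(n - k.+1)).
Definition den_poly n (p : {poly C}) := \poly_(k < n) ((n - k)%:R * p`_(n - k)).

Lemma signrr k : (-1) ^+ k * (-1) ^+ k = 1 :> C.
Proof. by rewrite -exprD addnn -mul2n exprM sqrrN !expr1n. Qed.

Lemma f_numE n (W : 'M[C]_n) z : f_num z W = (num_poly n (char_poly W)).[z].
Proof.
rewrite /f_num /num_poly horner_poly big_add1 /= big_mkord.
apply: eq_bigr => k _; congr (_ * _); rewrite /char_coef.
have := signrr k.+1; set s := (-1) ^+ k.+1 => ss.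
by rewrite -[RHS]mulr1 -ss; ring.
Qed.

Lemma f_denE n (W : 'M[C]_n) z : f_den z W = (den_poly n (char_poly W)).[z].
Proof.
rewrite /f_den /den_poly horner_poly big_mkord.
apply: eq_bigr => k _; congr (_ * _); rewrite /char_coef.
have := signrr k; set s := (-1) ^+ k => ss.
by rewrite -[RHS]mulr1 -ss; ring.
Qed.

Lemma expr_revE (z : C) n k : z != 0 -> (k < n)%N ->
  z ^+ n.-1 * z^-1 ^+ k = z ^+ (n - k.+1).
Proof.
move=> z0 kn; have -> : n.-1 = (n - k.+1 + k)%N by lia.
by rewrite exprD exprVn mulfK // expf_neq0.
Qed.

Lemma den_poly_circle n (p : {poly C}) z : (size p <= n.+1)%N -> z != 0 ->
  (den_poly n p).[z] = z ^+ n.-1 * p^`().[z^-1].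
Proof.
move=> sp z0; rewrite /den_poly horner_poly.
rewrite (@horner_coef_wide _ n); last first.
  by rewrite (leq_trans (size_poly _ _)) // -subn1 leq_subLR.
rewrite mulr_sumr (reindex_inj rev_ord_inj) /=.
apply: eq_bigr => k _; rewrite coef_deriv mulrCA expr_revE //.
by rewrite subKn // mulr_natl.
Qed.

Lemma num_poly_circle n (p : {poly C}) z : (size p <= n.+1)%N -> z != 0 ->
  (num_poly n p).[z] = z ^+ n.-1 * (n%:R * p.[z^-1] - z^-1 * p^`().[z^-1]).
Proof.
move=> sp z0; set w := z^-1.
have wp' : w * p^`().[w] = \sum_(i < n.+1) i%:R * p`_i * w ^+ i.
  rewrite (@horner_coef_wide _ n); last first.
    by rewrite (leq_trans (size_poly _ _)) // -subn1 leq_subLR.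
  rewrite big_ord_recl !mul0r add0r mulr_sumr; apply: eq_bigr => i _.
  by rewrite coef_deriv mulrCA -exprS mulr_natl.
rewrite wp' (horner_coef_wide _ sp) mulr_sumr -sumrB big_ord_recr /=.
rewrite mulrA subrr addr0 mulr_sumr /num_poly horner_poly.
rewrite (reindex_inj rev_ord_inj) /=; apply: eq_bigr => k _.
rewrite mulrA -mulrBl -mulrBl mulrCA expr_revE //.
congr (_ * _); rewrite -natrB; last by rewrite ltnW.
by rewrite -subSn // subSS (_ : (n - (n - k))%N = k) // subKn // ltnW.
Qed.

Lemma horner_num_Xn n (z : C) : (num_poly n 'X^n).[z] = 0.
Proof.
rewrite /num_poly horner_poly big1 // => k _; rewrite coefXn.
have -> : (n - k.+1 == n)%N = false by have := ltn_ord k; lia.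
by rewrite mulr0 mul0r.
Qed.

(** On the unit circle [|f(z; W)| < 1] for [W] in the spectral ball. *)
Lemma f_circle n (W : 'M[C]_n) z : (0 < n)%N -> spectral_ball W -> `|z| = 1 ->
  `|(num_poly n (char_poly W)).[z]| < `|(den_poly n (char_poly W)).[z]|.
Proof.
move=> n0 /spectral_ballP W1 z1.
have z0 : z != 0 by rewrite -normr_gt0 z1.
have [rs [pE rsn]] := char_poly_roots W.
have sp : (size (char_poly W) <= n.+1)%N by rewrite size_char_poly.
rewrite num_poly_circle // den_poly_circle // !normrM normrX z1 expr1n !mul1r.
rewrite pE -rsn; apply: circle_deriv_bound; rewrite ?rsn //.
  by move=> r rrs; apply: W1; rewrite (eigenvalue_rootsE _ pE).
by rewrite normfV z1 invr1.
Qed.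

(** The companion matrix of a monic polynomial is non-derogatory: an
    eigenvector is determined by its last coordinate. *)
Lemma companion_non_derogatory (p : {poly C}) : p \is monic -> (1 < size p)%N ->
  non_derogatory (companionmx p).
Proof.
move=> pm sp a aW; set E := eigenspace _ _.
have E0 : (0 < \rank E)%N by rewrite lt0n mxrank_eq0.
apply/eqP; rewrite eqn_leq E0 andbT.
have dP : (0 < (size p).-1)%N by rewrite -subn1 subn_gt0.
pose d := (size p).-1.-1.
have dlt : (d < (size p).-1)%N by rewrite /d ltn_predL.
pose last : 'I_(size p).-1 := Ordinal dlt.
pose L : 'cV[C]_(size p).-1 := delta_mx last 0.
have <- := mxrank_mul_ker E L.
suff -> : (E :&: kermx L)%MS = 0 by rewrite mxrank0 addn0 rank_leq_col.
apply/eqP; rewrite -submx0; apply/rV_subP => u.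
rewrite sub_capmx => /andP[/eigenspaceP uE /sub_kermxP uL].
have ul : u 0 last = 0.
  move/matrixP/(_ 0 0): uL; rewrite !mxE (bigD1 last) //= big1 => [|i il].
    by rewrite mxE !eqxx mulr1 addr0.
  by rewrite mxE (negPf il) mulr0.
rewrite submx0; apply/eqP/matrixP => i j; rewrite ord1 mxE.
have : forall k (j : 'I_(size p).-1), (j + k = d)%N -> u 0 j = 0.
  elim=> [|k IH] b bk.
    by rewrite (_ : b = last) //; apply: val_inj; rewrite /= -bk addn0.
  have b1 : (b.+1 < (size p).-1)%N.
    apply: (leq_ltn_trans _ dlt); rewrite -bk addnS ltnS; exact: leq_addr.
  have := congr1 (fun v : 'rV_(size p).-1 => v 0 (Ordinal b1)) uE.
  rewrite !mxE (IH (Ordinal b1)) ?mulr0; last by rewrite /= -bk addnS addSn.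
  rewrite (bigD1 b) //= big1 => [|l lb].
    rewrite mxE /= eqxx ifF ?mulr1 ?addr0 //.
    by apply/negbTE; rewrite neq_ltn; apply/orP; left; rewrite -ltnS prednK.
  rewrite mxE /=; case: ifP => [/eqP ll|_].
    by rewrite (_ : l = last) ?ul ?mul0r //; apply: val_inj.
  by rewrite eqSS (negPf (_ : (l : nat) != b)) ?mulr0 // .
move=> /(_ (d - j)%N j); apply; rewrite subnKC //.
by rewrite /d -ltnS prednK.
Qed.

Lemma non_derogatory_exists n (p : {poly C}) : p \is monic -> size p = n.+1 ->
  (0 < n)%N -> exists W : 'M[C]_n, char_poly W = p /\ non_derogatory W.
Proof.
move=> pm sp n0; have <- : (size p).-1 = n by rewrite sp.
exists (companionmx p); split; first exact: companionmxK.
by apply: companion_non_derogatory; rewrite // sp.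
Qed.

(** The value of the form at [(x, y)] is [|x + y|^2 + (a - 1) |y|^2]. *)
Lemma psd_2x2 (a : C) : 1 <= a ->
  psd_mx (\matrix_(j < 2, k < 2) (if (j == 1) && (k == 1) then a else 1) : 'M[C]_2).
Proof.
move=> a1; have aR : a \is Num.real by rewrite ger0_real // (le_trans ler01).
split.
  apply/is_hermitianmxP; rewrite expr0 scale1r; apply/matrixP => j k.
  rewrite !mxE andbC; case: ifP => _; last by rewrite rmorph1.
  by rewrite /= conj_Creal.
move=> u; rewrite mxE !big_ord_recl big_ord0 !mxE !big_ord_recl !big_ord0 !mxE /=.
set x := u _ _; set y := u _ _.
rewrite (_ : _ + _ = `|x + y| ^+ 2 + (a - 1) * `|y| ^+ 2).
  by rewrite addr_ge0 ?mulr_ge0 ?exprn_ge0 ?normr_ge0 ?subr_ge0.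
by rewrite !normCK rmorphD; ring.
Qed.

End RationalFunction.

(** * Polynomials vanishing to second order at the roots of unity *)

Section CirclePolynomials.
Variable R : realType.
Local Notation C := R[i].
Local Notation "x %:C" := (real_complex R x).
Implicit Types (p q : {poly C}) (z w : C).

Lemma poly_circle_bounded p :
  exists2 B : R, 0 <= B & forall z, `|z| = 1 -> `|p.[z]| <= B%:C.
Proof.
have [|B B0 BE] := @ge0_realE _ (\sum_(i < size p) `|p`_i|).
  by apply: sumr_ge0 => i _; exact: normr_ge0.
exists B => // z z1; rewrite -BE horner_coef.
apply: le_trans (ler_norm_sum _ _ _) _; apply: ler_sum => i _.
by rewrite normrM normrX z1 expr1n mulr1.
Qed.

(** Points of the circle other than [w] and arbitrarily close to it: [w] times
    [(1 + i t) / (1 - i t)]. *)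
Lemma circle_points w (e : R) : `|w| = 1 -> 0 < e ->
  exists z, [/\ `|z| = 1, z != w & `|z - w| <= e%:C].
Proof.
move=> w1 e0; pose t := e / 2; have t0 : 0 < t by rewrite divr_gt0.
pose a := Complex 1 t; pose b := Complex 1 (- t).
have nab : `|a| = `|b| by rewrite !normc_def /= sqrrN.
have nb1 : 1 <= `|b|.
  rewrite normc_def -[leLHS](rmorph1 (real_complex R)) lecR -[leLHS]sqrtr1.
  by rewrite ler_wsqrtr //= expr1n lerDl sqr_ge0.
have b0 : b != 0 by rewrite -normr_gt0 (lt_le_trans ltr01).
have ab : a - b = Complex 0 e by rewrite /a /b; simpc; congr Complex; rewrite /t; lra.
have zw : w * (a / b) - w = w * ((a - b) / b) by field.
have nab0 : `|a - b| = e%:C.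
  by rewrite ab normc_def /= expr0n add0r sqrtr_sqr ger0_norm // ltW.
exists (w * (a / b)); split.
- by rewrite normrM w1 mul1r normf_div nab divff // normr_eq0.
- rewrite -subr_eq0 zw -normr_gt0 normrM w1 mul1r normf_div nab0 divr_gt0 //.
    by rewrite ltcR.
  by rewrite normr_gt0.
- rewrite zw normrM w1 mul1r normf_div nab0 ler_pdivrMr ?normr_gt0 //.
  by rewrite ler_peMr // ler0c ltW.
Qed.

Lemma circle_double_root p w (K : R) : `|w| = 1 ->
    (forall z, `|z| = 1 -> `|p.[z]| <= K%:C * `|z - w| ^+ 2) ->
  root p w /\ root p^`() w.
Proof.
move=> w1 pK; have pw : root p w.
  by rewrite /root -normr_le0 (le_trans (pK _ w1)) // subrr normr0 expr0n mulr0.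
split=> //; have /factor_theorem[q pE] := pw.
have qK z : `|z| = 1 -> z != w -> `|q.[z]| <= K%:C * `|z - w|.
  move=> z1 zw; have zw0 : 0 < `|z - w| by rewrite normr_gt0 subr_eq0.
  have := pK z z1; rewrite pE hornerM hornerXsubC normrM expr2 mulrA.
  by rewrite ler_pM2r.
have /factor_theorem[s sE] : root (q - q.[w]%:P) w.
  by rewrite /root !hornerE subrr.
have [B B0 sB] := poly_circle_bounded s.
suff qw : q.[w] = 0.
  by rewrite pE derivM derivXsubC /root !hornerE qw subrr mulr0 addr0.
apply/eqP; rewrite -normr_le0.
have [x x0 xE] := ge0_realE (normr_ge0 q.[w]).
rewrite xE (lecR x 0); apply/ler_addgt0Pr => e e0; rewrite add0r.
pose d := e / (`|K| + B + 1).
have k1 : 0 < `|K| + B + 1 by rewrite ltr_wpDl // addr_ge0.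
have [z [z1 zw zd]] := circle_points w1 (divr_gt0 e0 k1).
have : q.[z] - q.[w] = s.[z] * (z - w).
  by have := congr1 (fun r : {poly C} => r.[z]) sE; rewrite /= !hornerE.
move=> /(canRL (addrNK _)) /(canLR (addKr _)) => qwE.
have [y y0 yE] := ge0_realE (normr_ge0 (z - w)).
rewrite -lecR -xE (_ : q.[w] = q.[z] - s.[z] * (z - w)); last by rewrite -qwE; ring.
apply: le_trans (ler_normB _ _) _; rewrite normrM.
apply: le_trans (lerD (qK z z1 zw) (ler_wpM2r (normr_ge0 _) (sB z z1))) _.
move: zd; rewrite yE -!rmorphM -rmorphD !lecR ler_pdivlMr // => yd.
have := ler_wpM2r y0 (ler_norm K); lra.
Qed.

Lemma dvdp_Xn_sub_1 p m : (0 < m)%N ->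
  (forall w, w ^+ m = 1 -> root p w) -> ('X^m - 1) %| p.
Proof.
move=> m0 pw; have [rs rsE] := closed_field_poly_normal ('X^m - 1 : {poly C}).
move: rsE; rewrite lead_coefXnsubC // scale1r => rsE.
rewrite rsE; apply: uniq_roots_dvdp.
  apply/allP => w wrs; apply: pw.
  have : root ('X^m - 1) w by rewrite rsE root_prod_XsubC.
  by rewrite /root !hornerE subr_eq0 => /eqP.
rewrite uniq_rootsE -separable_prod_XsubC -rsE separable_Xn_sub_1 //.
by rewrite pnatr_eq0 -lt0n.
Qed.

(** The coefficients of a multiple of ['X^m - 1] add up to zero over each class
    of degrees modulo [m]; up to degree [2 m] the class of [m - 1] consists of
    [m - 1] and [2 m - 1]. *)
Lemma coef_dvd_Xn_sub_1 p m : (1 < m)%N -> ('X^m - 1) %| p ->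
  (size p <= m.*2.+1)%N -> p`_m.-1 + p`_(m.*2.-1) = 0.
Proof.
move=> m1 /dvdpP[q ->] sp.
have [->|q0] := eqVneq q 0; first by rewrite mul0r !coef0 addr0.
have sq : (size q <= m.+1)%N.
  move: sp; rewrite size_Mmonic ?monicXnsubC ?size_XnsubC //; [|lia..].
  by move: (size q) => k; lia.
have h1 : (m.-1 < m)%N by lia.
have h2 : (m.*2.-1 < m)%N = false by lia.
have h3 : (m.*2.-1 - m)%N = m.-1 by lia.
rewrite mulrBr mulr1 !coefB !coefMXn h1 h2 h3.
by rewrite [q`_m.*2.-1]nth_default ?subr0 ?sub0r ?addNr // (leq_trans sq); lia.
Qed.

(** A polynomial of degree at most [2 m] that is [O(|z ^ m - 1| ^ 2)] on the
    unit circle is a multiple of [('X^m - 1) ^ 2]. The proof only uses that [p]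
    and ['X * p^`()] are multiples of ['X^m - 1], which gives two independent
    linear relations between the coefficients of degrees [m - 1] and
    [2 m - 1]. *)
Lemma circle_square_coef p m (K : R) : (1 < m)%N -> 0 <= K ->
    (size p <= m.*2.+1)%N ->
    (forall z, `|z| = 1 -> `|p.[z]| <= K%:C * `|z ^+ m - 1| ^+ 2) ->
  p`_m.-1 = 0 /\ p`_(m.*2.-1) = 0.
Proof.
move=> m1 K0 sp pK.
have roots w : w ^+ m = 1 -> root p w /\ root p^`() w.
  move=> wm; have w1 : `|w| = 1.
    apply/eqP; rewrite -(@eqrXn2 _ m) ?normr_ge0 //; last by lia.
    by rewrite -normrX wm normr1 expr1n.
  apply: (@circle_double_root _ _ (K * m%:R ^+ 2)) => // z z1.
  apply: le_trans (pK z z1) _; rewrite rmorphM -mulrA ler_wpM2l ?ler0c //.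
  rewrite rmorphXn rmorph_nat -exprMn ler_pXn2r ?nnegrE ?mulr_ge0 ?normr_ge0 //.
  rewrite -[X in _ - X]wm subrXX normrM mulrC ler_wpM2r ?normr_ge0 //.
  apply: le_trans (ler_norm_sum _ _ _) _.
  rewrite (eq_bigr (fun=> 1)) ?sumr_const ?card_ord // => i _.
  by rewrite normrM !normrX z1 w1 !expr1n mulr1.
have m0 : (0 < m)%N by lia.
have dp : ('X^m - 1) %| p by apply: dvdp_Xn_sub_1 => // w /roots[].
have dp' : ('X^m - 1) %| 'X * p^`().
  by apply/dvdp_mull/dvdp_Xn_sub_1 => // w /roots[].
have sp' : (size ('X * p^`() : {poly C})%R <= m.*2.+1)%N.
  rewrite (leq_trans (size_polyMleq _ _)) // size_polyX /=.
  have [->|p0] := eqVneq p 0; first by rewrite deriv0 size_poly0.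
  exact: leq_trans (lt_size_deriv p0) sp.
have c1 := coef_dvd_Xn_sub_1 m1 dp sp.
have := coef_dvd_Xn_sub_1 m1 dp' sp'.
have e1 : (m.-1 == 0)%N = false by lia.
have e2 : (m.*2.-1 == 0)%N = false by lia.
rewrite !coefXM e1 e2 !coef_deriv.
have -> : m.-1.-1.+1 = m.-1 by lia.
have -> : m.*2.-1.-1.+1 = m.*2.-1 by lia.
have p1 : p`_m.-1 = - p`_m.*2.-1 by apply/eqP; rewrite -addr_eq0 c1.
rewrite p1 mulNrn addrC => c2.
have : p`_m.*2.-1 *+ (m.*2.-1 - m.-1) = 0 by rewrite mulrnBr ?c2 //; lia.
rewrite (_ : (m.*2.-1 - m.-1)%N = m); last by lia.
move=> /eqP; rewrite mulrn_eq0 => /orP[/eqP|/eqP p0]; first by lia.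
by rewrite p0 oppr0.
Qed.

End CirclePolynomials.

(** * The data and the obstruction *)

Section Obstruction.
Variables (R : realType) (m : nat).
Hypothesis m1 : (1 < m)%N.
Local Notation C := R[i].
Local Notation "x %:C" := (real_complex R x).
Local Notation n := m.+1.

Variable c : R.

(** The characteristic polynomial of the matrix at the node [1 / 2]. *)
Definition data_p : {poly C} := 'X^n - c%:C *: 'X.

Lemma coef_data_p k : data_p`_k = (k == n)%:R - c%:C * (k == 1)%:R.
Proof. by rewrite coefB coefXn coefZ coefX. Qed.

Lemma data_p_monic : data_p \is monic /\ size data_p = n.+1.
Proof.
have sz : (size (- (c%:C *: 'X) : {poly C})%R < size ('X^n : {poly C})%R)%N.
  rewrite size_polyN size_polyXn (leq_ltn_trans (size_scale_leq _ _)) //.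
  by rewrite size_polyX; lia.
split; last by rewrite size_polyDl // size_polyXn.
by rewrite monicE lead_coefDl // lead_coefXn.
Qed.

Lemma num_data : num_poly n data_p = - (m%:R * c%:C) *: 'X^(m.-1).
Proof.
apply/polyP => k; rewrite coef_poly coefZ coefXn coef_data_p.
case: (ltnP k n) => kn; last by rewrite (_ : (k == m.-1) = false) ?mulr0 //; lia.
have -> : (n - k.+1 == n)%N = false by lia.
have -> : (n - k.+1 == 1)%N = (k == m.-1) by lia.
case: eqP => [->|_]; last by rewrite !mulr0 subr0 mulr0.
by rewrite sub0r !mulr1 mulrN prednK //; lia.
Qed.

Lemma den_data : den_poly n data_p = n%:R%:P - c%:C *: 'X^m.
Proof.
apply/polyP => k; rewrite coef_poly coef_data_p coefB coefC coefZ coefXn.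
case: (ltnP k n) => kn; last first.
  by rewrite (_ : (k == 0)%N = false) 1?(_ : (k == m) = false) ?mulr0 ?subr0 //; lia.
have -> : (n - k == n)%N = (k == 0)%N by lia.
have -> : (n - k == 1)%N = (k == m) by lia.
case: eqP => [->|k0].
  by rewrite subn0 (_ : (0 == m)%N = false) ?mulr0 ?subr0 ?mulr1 //; lia.
case: eqP => [->|km]; last by rewrite !mulr0 subr0 mulr0.
by rewrite subSnn mul1r.
Qed.

Lemma Xn_ball (W : 'M[C]_n) : char_poly W = 'X^n -> spectral_ball W.
Proof.
move=> Wp; apply/spectral_ballP => a.
by rewrite eigenvalue_root_char Wp /root !hornerE expf_eq0 => /andP[_ /eqP->]; rewrite normr0.
Qed.

(** If [N], [D] and [N'], [D'] are the numerators and denominators of [f] for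
    [p] and for [data_p], this is [N D' + N' D]. *)
Definition cross_poly (p : {poly C}) : {poly C} :=
  num_poly n p * den_poly n data_p + num_poly n data_p * den_poly n p.

Lemma size_cross_poly p : (size (cross_poly p) <= m.*2.+1)%N.
Proof.
have prod_size (q r : {poly C}) : (size q <= n)%N -> (size r <= n)%N ->
    (size (q * r)%R <= m.*2.+1)%N.
  move=> qn rn; apply: leq_trans (size_polyMleq _ _) _.
  by move: (size q) (size r) qn rn => a b; lia.
rewrite (leq_trans (size_polyD _ _)) // geq_max.
by rewrite !prod_size ?size_poly.
Qed.

Lemma coef_cross_poly p k : (cross_poly p)`_k = n%:R * (num_poly n p)`_k
  - c%:C * (if (k < m)%N then 0 else (num_poly n p)`_(k - m))
  - m%:R * c%:C * (if (k < m.-1)%N then 0 else (den_poly n p)`_(k - m.-1)).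
Proof.
rewrite /cross_poly num_data den_data coefD mulrBr coefB mulrC mul_polyC coefZ.
by rewrite -scalerAr coefZ coefMXn -scalerAl coefZ coefXnM mulNr.
Qed.

Lemma cross_poly_coef1 p :
  (cross_poly p)`_m.-1 = n%:R * m%:R * (p`_1 - c%:C * p`_n).
Proof.
rewrite coef_cross_poly ltnn subnn !coef_poly.
have -> : (m.-1 < n)%N by lia.
have -> : (m.-1 < m)%N by lia.
rewrite /= prednK; last by lia.
by rewrite subn0 subSnn; ring.
Qed.

Lemma cross_poly_coef2 p :
  (cross_poly p)`_(m.*2.-1) = - 2 * m%:R * c%:C * p`_1.
Proof.
rewrite coef_cross_poly !coef_poly.
have -> : (m.*2.-1 < n)%N = false by lia.
have -> : (m.*2.-1 < m)%N = false by lia.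
have -> : (m.*2.-1 < m.-1)%N = false by lia.
have -> : (m.*2.-1 - m)%N = m.-1 by lia.
have -> : (m.*2.-1 - m.-1)%N = m by lia.
have -> : (m.-1 < n)%N by lia.
rewrite ltnSn prednK; last by lia.
by rewrite subSnn; ring.
Qed.

(* [cE] makes [1 / 2] the maximum of [|f(z; W)|] over the closed disc, for a
   matrix [W] with characteristic polynomial [data_p] *)
Hypotheses (c_gt0 : 0 < c) (c_lt1 : c < 1) (cE : 2 * m%:R * c = n%:R - c).

Lemma data_den_ge (z : C) : `|z| <= 1 ->
  (n%:R - c)%:C <= `|(den_poly n data_p).[z]|.
Proof.
move=> z1; rewrite den_data !hornerE.
apply: le_trans (lerB_dist _ _); rewrite normr_nat rmorphB rmorph_nat lerD2l lerN2.
rewrite normrM normrX ger0_norm ?ler0c ?(ltW c_gt0) //.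
by rewrite ler_piMr ?ler0c ?(ltW c_gt0) ?exprn_ile1 ?normr_ge0.
Qed.

Lemma data_den_gt0 : 0 < n%:R - c :> R.
Proof. by rewrite -cE !mulr_gt0 ?ltr0n ?c_gt0 //; lia. Qed.

Lemma data_f_bound (z : C) : `|z| <= 1 ->
  `|(num_poly n data_p).[z] / (den_poly n data_p).[z]| <= 1 / 2.
Proof.
move=> z1; have D0 := data_den_ge z1.
have Dp : 0 < `|(den_poly n data_p).[z]|.
  by apply: lt_le_trans D0; rewrite ltcR data_den_gt0.
rewrite normf_div ler_pdivrMr // mulrC.
apply: le_trans (_ : (n%:R - c)%:C * (1 / 2) <= _); last first.
  by rewrite ler_wpM2r // divr_ge0.
rewrite -cE num_data !hornerE normrM normrN normrM normrX normr_nat.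
rewrite ger0_norm ?ler0c ?(ltW c_gt0) //.
rewrite !rmorphM !rmorph_nat /=.
have -> : 2 * m%:R * c%:C * 1 / 2 = m%:R * c%:C by field.
by rewrite ler_piMr ?mulr_ge0 ?ler0c ?(ltW c_gt0) ?exprn_ile1 ?normr_ge0.
Qed.

Lemma data_ball (W : 'M[C]_n) : char_poly W = data_p -> spectral_ball W.
Proof.
move=> Wp; apply/spectral_ballP => a.
rewrite eigenvalue_root_char Wp /root !hornerE subr_eq0 exprS.
have [->|a0] := eqVneq a 0; first by rewrite normr0.
rewrite mulrC => /eqP /(mulIf a0) am.
rewrite real_ltNge ?normr_real ?real1 //; apply/negP => a1.
have := exprn_ege1 m a1; rewrite -normrX am ger0_norm ?ler0c ?(ltW c_gt0) //.
by rewrite -(rmorph1 (real_complex R)) lecR leNgt c_lt1.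
Qed.

(** Writing [f = N / D], on the unit circle [|D|^2 - 4 |N|^2], which measures by
    how much [|f|] stays below [1 / 2], is proportional to [|z^m - 1|^2]. *)
Lemma data_defect (z : C) : `|z| = 1 ->
  `|(den_poly n data_p).[z]| ^+ 2 - 4 * `|(num_poly n data_p).[z]| ^+ 2
    = (n%:R * c)%:C * `|z ^+ m - 1| ^+ 2.
Proof.
move=> z1; have -> : (den_poly n data_p).[z] = n%:R - c%:C * z ^+ m.
  by rewrite den_data !hornerE.
have -> : `|(num_poly n data_p).[z]| = m%:R * c%:C.
  rewrite num_data hornerZ hornerXn normrM normrX z1 expr1n mulr1 normrN normrM.
  by rewrite normr_nat ger0_norm // ler0c ltW.
have cEC : 2 * m%:R * c%:C = n%:R - c%:C.
  by have := congr1 (real_complex R) cE; rewrite rmorphB !rmorphM !rmorph_nat.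
have zm : (z ^+ m) * (z ^+ m)^* = 1 by rewrite -normCK normrX z1 !expr1n.
have cJ : (c%:C)^* = c%:C by rewrite conj_Creal // ger0_real // ler0c ltW.
rewrite (_ : 4 * _ = (n%:R - c%:C) ^+ 2); last by rewrite -cEC; ring.
rewrite !normCK !rmorphB !rmorphM rmorph1 !rmorph_nat /= cJ.
move: zm; set w := z ^+ m => zm.
rewrite [LHS](_ : _ = 2 * n%:R * c%:C - n%:R * c%:C * w - n%:R * c%:C * w^*
   + c%:C ^+ 2 * (w * w^* - 1)); last by ring.
rewrite [RHS](_ : _ = n%:R * c%:C * (w * w^*) + n%:R * c%:C
   - n%:R * c%:C * w - n%:R * c%:C * w^*); last by ring.
by rewrite zm; ring.
Qed.

(** Only the characteristic polynomials of the interpolated values matter. *)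
Lemma no_interpolant (F : C -> 'M[C]_n) :
    holomorphic_on_disc F -> (forall z, unit_disc z -> spectral_ball (F z)) ->
    char_poly (F 0) = 'X^n -> char_poly (F (1 / 2)) = data_p -> False.
Proof.
move=> hF ballF F0 F12.
pose N z l := (num_poly n (char_poly (F l))).[z].
pose D z l := (den_poly n (char_poly (F l))).[z].
have n0 : (0 < n)%N by [].
have ND z l : `|z| = 1 -> `|l| < 1 -> `|N z l| < `|D z l|.
  by move=> z1 l1; apply: f_circle => //; exact: ballF.
have holoN z l : `|l| < 1 -> holo (N z) l.
  move=> l1; have hp := holo_char_poly (hF l l1).
  rewrite /N; under [X in holo X]eq_fun do rewrite horner_poly.
  apply: holo_sum => i _; apply: holoM; last exact: holo_cst.
  by apply: holoM; [exact: holo_cst|exact: hp].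
have holoD z l : `|l| < 1 -> holo (D z) l.
  move=> l1; have hp := holo_char_poly (hF l l1).
  rewrite /D; under [X in holo X]eq_fun do rewrite horner_poly.
  apply: holo_sum => i _; apply: holoM; last exact: holo_cst.
  by apply: holoM; [exact: holo_cst|exact: hp].
have half1 : `|1 / 2 : C| < 1.
  by rewrite ger0_norm ?divr_ge0 // ltr_pdivrMr // mul1r ltr1n.
have mhalf1 : `|- (1 / 2) : C| < 1 by rewrite normrN.
have half0 : (1 / 2 : C) != 0 by rewrite mul1r invr_eq0 pnatr_eq0.
have mhalf0 : - (1 / 2 : C) != 0 by rewrite oppr_eq0.
(* the Schwarz-Pick inequality for [l |-> f(z; F l) / l], whose values at
   [1 / 2] and [- 1 / 2] are [2 N / D] and [- 2 N / D] *)
have pick z : `|z| = 1 ->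
    `|N z (- (1 / 2)) / D z (- (1 / 2)) + N z (1 / 2) / D z (1 / 2)|
      <= 2 * (1 - 4 * `|N z (1 / 2) / D z (1 / 2)| ^+ 2).
  move=> z1; pose g l := N z l / D z l.
  have D0 l : `|l| < 1 -> D z l != 0.
    by move=> l1; rewrite -normr_gt0 (le_lt_trans _ (ND z l z1 l1)) ?normr_ge0.
  have hg l : `|l| < 1 -> holo g l.
    by move=> l1; apply: holoM; [exact: holoN|apply: holoV; [exact: holoD|exact: D0]].
  have g1 l : `|l| < 1 -> `|g l| <= 1.
    move=> l1; rewrite normf_div ler_pdivrMr ?normr_gt0 ?D0 // mul1r.
    exact/ltW/ND.
  have g0 : g 0 = 0 by rewrite /g /N F0 horner_num_Xn mul0r.
  pose h l := g l / l.
  have h1 l : `|l| < 1 -> `|h l| <= 1 by apply: schwarz.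
  have hh l : `|l| < 1 -> l != 0 -> holo h l.
    by move=> l1 l0; apply: holoM; [exact: hg|apply: holoV => //; exact: holo_id].
  have := schwarz_pick hh h1 half1 half0 mhalf1 mhalf0.
  have kE : h (1 / 2) = 2 * g (1 / 2) by rewrite /h; field.
  have lE : h (- (1 / 2)) = - 2 * g (- (1 / 2)) by rewrite /h; field.
  have -> : (1 / 2 : C)^* = 1 / 2 by rewrite conj_Creal // ger0_real // divr_ge0.
  have -> : 1 - 1 / 2 * - (1 / 2) = 5 / 4 :> C by field.
  have -> : - (1 / 2) - 1 / 2 = - 1 :> C by field.
  rewrite normrN1 mulr1 [`|5 / 4|]ger0_norm ?divr_ge0 //.
  have : `|1 - (h (1 / 2))^* * h (- (1 / 2))|
      <= (1 - `|h (1 / 2)| ^+ 2) + `|h (- (1 / 2)) - h (1 / 2)|.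
    rewrite (_ : 1 - _ = (1 - `|h (1 / 2)| ^+ 2)
      - (h (1 / 2))^* * (h (- (1 / 2)) - h (1 / 2))); last by rewrite normCK; ring.
    apply: le_trans (ler_normB _ _) _; rewrite ger0_norm.
      by rewrite lerD2l normrM norm_conjC ler_piMl ?normr_ge0 ?h1.
    by rewrite subr_ge0 expr_le1 ?normr_ge0 ?h1.
  have -> : `|h (- (1 / 2)) - h (1 / 2)| = 2 * `|g (- (1 / 2)) + g (1 / 2)|.
    by rewrite lE kE mulNr -opprD -mulrDr normrN normrM normr_nat.
  have -> : `|h (1 / 2)| ^+ 2 = 4 * `|g (1 / 2)| ^+ 2.
    by rewrite kE normrM normr_nat; ring.
  move=> H1 H2; have := le_trans H2 H1; rewrite -subr_ge0 => H.
  rewrite -subr_ge0; set x := `|_ + _| in H *; set y := `|g _| in H *.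
  suff -> : 2 * (1 - 4 * y ^+ 2) - x =
      2 * (1 - 4 * y ^+ 2 + 2 * x - 2 * x * (5 / 4)) by rewrite mulr_ge0.
  by field.
have [B B0 DB] := poly_circle_bounded (den_poly n (char_poly (F (- (1 / 2))))).
pose chi := char_poly (F (- (1 / 2))).
pose p := cross_poly chi.
have pK z : `|z| = 1 -> `|p.[z]| <=
    (2 * B * (n%:R * c) / (n%:R - c))%:C * `|z ^+ m - 1| ^+ 2.
  move=> z1; have zle1 : `|z| <= 1 by rewrite z1.
  have D'ge := data_den_ge zle1; have nc0 := data_den_gt0.
  have D'0 : 0 < `|(den_poly n data_p).[z]|.
    by apply: lt_le_trans D'ge; rewrite ltcR.
  have D0 : 0 < `|(den_poly n chi).[z]|.
    by apply: le_lt_trans (ND z (- (1 / 2)) z1 mhalf1); exact: normr_ge0.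
  have := pick z z1; rewrite /N /D F12 -/chi => le_defect.
  have -> : p.[z] = ((num_poly n chi).[z] / (den_poly n chi).[z]
      + (num_poly n data_p).[z] / (den_poly n data_p).[z])
      * ((den_poly n chi).[z] * (den_poly n data_p).[z]).
    rewrite /p /cross_poly hornerD !hornerM; rewrite !normr_gt0 in D0 D'0; field.
    by rewrite D0 D'0.
  rewrite normrM normrM; apply: le_trans (ler_wpM2r _ le_defect) _.
    by rewrite mulr_ge0 ?normr_ge0.
  rewrite normf_div.
  have defect := data_defect z1; set N' := `|(num_poly n data_p).[z]| in defect *.
  set D' := `|(den_poly n data_p).[z]| in defect D'0 D'ge *.
  have -> : 2 * (1 - 4 * (N' / D') ^+ 2) * (`|(den_poly n chi).[z]| * D')
      = 2 * `|(den_poly n chi).[z]| * (D' ^+ 2 - 4 * N' ^+ 2) / D'.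
    by field; rewrite gt_eqF.
  rewrite defect ler_pdivrMr //.
  set K := n%:R * c; set E := `|z ^+ m - 1| ^+ 2.
  have K0 : 0 <= K by rewrite mulr_ge0 // ltW.
  have -> : (2 * B * K / (n%:R - c))%:C * E * D'
      = 2 * (K%:C * E) * (B%:C * ((n%:R - c)^-1%:C * D')).
    by rewrite !rmorphM rmorph_nat; ring.
  have -> : 2 * `|(den_poly n chi).[z]| * (K%:C * E)
      = 2 * (K%:C * E) * `|(den_poly n chi).[z]| by ring.
  have E0 : 0 <= E by rewrite exprn_ge0.
  have KE0 : 0 <= 2 * (K%:C * E) by rewrite mulr_ge0 // mulr_ge0 // ler0c.
  rewrite ler_wpM2l //.
  apply: le_trans (DB z z1) _; rewrite ler_peMr ?ler0c //.
  by rewrite fmorphV ler_pdivlMl ?mulr1 // ltcR.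
have [|c1 c2] := circle_square_coef m1 _ (size_cross_poly chi) pK.
  by rewrite divr_ge0 ?(ltW data_den_gt0) // !mulr_ge0 ?(ltW c_gt0).
have chin : chi`_n = 1.
  have := char_poly_monic (F (- (1 / 2))); rewrite monicE /lead_coef size_char_poly.
  by move/eqP.
rewrite cross_poly_coef1 chin mulr1 in c1; rewrite cross_poly_coef2 in c2.
have cC0 : c%:C != 0 by rewrite gt_eqF // ltcR.
have mC0 : (m%:R : C) != 0 by rewrite pnatr_eq0 -lt0n ltnW.
have nC0 : (n%:R : C) != 0 by rewrite pnatr_eq0.
move/eqP: c1; rewrite !mulf_eq0 (negPf mC0) (negPf nC0) /= subr_eq0 => /eqP chi1.
move/eqP: c2; rewrite chi1 !mulf_eq0 (negPf cC0) (negPf mC0) !orbF.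
by rewrite oppr_eq0 pnatr_eq0.
Qed.

End Obstruction.

Theorem mainTheorem1 (R : realType) (n : nat) (hn : (3 <= n)%N) :
  exists (M : nat) (zeta : 'I_M -> R[i]) (W : 'I_M -> 'M[R[i]]_n),
    [/\ (0 < M)%N,
        injective zeta /\ (forall j, unit_disc (zeta j)),
        (forall j, non_derogatory (W j) /\ spectral_ball (W j)),
        (forall z : R[i], closed_unit_disc z -> psd_mx (pick_mx z zeta W)) &
        ~ exists F : R[i] -> 'M[R[i]]_n,
            [/\ holomorphic_on_disc F,
                (forall z, unit_disc z -> spectral_ball (F z)) &
                (forall j, F (zeta j) = W j)]].
Proof.
case: n hn => // m; rewrite ltnS => m1.
(* the constant for which [2 m c = m + 1 - c] *)
pose c : R := m.+1%:R / (m.+1 + m)%:R.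
have c_gt0 : 0 < c by rewrite divr_gt0 ?ltr0n.
have c_lt1 : c < 1 by rewrite ltr_pdivrMr ?ltr0n // mul1r ltr_nat; lia.
have cE : 2 * m%:R * c = m.+1%:R - c.
  rewrite /c natrD -natr1; field.
  by rewrite nat1r -natrD pnatr_eq0.
have [W0 [W0p W0nd]] := @non_derogatory_exists R m.+1 'X^(m.+1)
  (monicXn _ _) (size_polyXn _ _) isT.
have [dm ds] := data_p_monic m1 c.
have [W1 [W1p W1nd]] := non_derogatory_exists dm ds isT.
pose zeta (j : 'I_2) : R[i] := if j == 0 then 0 else 1 / 2.
pose W (j : 'I_2) := if j == 0 then W0 else W1.
have half1 : `|1 / 2 : R[i]| < 1.
  by rewrite ger0_norm ?divr_ge0 // ltr_pdivrMr // mul1r ltr1n.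
have half0 : (1 / 2 : R[i]) != 0 by rewrite mul1r invr_eq0 pnatr_eq0.
exists 2%N, zeta, W; split; first exact: isT.
- split=> [j k|j]; last first.
    by rewrite /unit_disc /zeta /=; case: ifP => _ //; rewrite normr0.
  case: j k => [[|[|//]] hj] [[|[|//]] hk] //= h; first exact/val_inj.
  + by move: h half0; rewrite /zeta /= => <-; rewrite eqxx.
  + by move: h half0; rewrite /zeta /= => ->; rewrite eqxx.
  + exact/val_inj.
- move=> j; rewrite /W; case: ifP => _; split => //; first exact: Xn_ball W0p.
  exact: (data_ball c_gt0 c_lt1 W1p).
- move=> z z1.
  have f0 : f_val z W0 = 0 by rewrite /f_val f_numE W0p horner_num_Xn mul0r.
  have f1 : `|f_val z W1| <= 1 / 2.
    by rewrite /f_val f_numE f_denE W1p; exact: (data_f_bound m1 c_gt0 c_lt1 cE).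
  pose a := (1 - `|f_val z W1| ^+ 2) / (3 / 4).
  have a1 : 1 <= a.
    rewrite ler_pdivlMr ?divr_gt0 // mul1r lerBrDr -lerBrDl.
    rewrite (_ : 1 - 3 / 4 = (1 / 2) ^+ 2); last by field.
    by rewrite ler_pXn2r ?nnegrE ?normr_ge0 ?divr_ge0.
  rewrite (_ : pick_mx z zeta W = \matrix_(j, k) (if (j == 1) && (k == 1) then a else 1)).
    exact: psd_2x2.
  have halfJ : (1 / 2 : R[i])^* = 1 / 2.
    by rewrite conj_Creal // ger0_real // divr_ge0.
  apply/matrixP => j k; rewrite !mxE.
  case: j k => [[|[|//]] hj] [[|[|//]] hk]; rewrite /W /zeta /= ?f0 ?halfJ.
  + by rewrite conjC0 !mul0r !subr0 divr1.
  + by rewrite conjC0 !mul0r !subr0 divr1.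
  + by rewrite !mulr0 !subr0 divr1.
  + by rewrite /a normCK [_ * (f_val z W1)^*]mulrC; congr (_ / _); field.
- case=> F [hF ballF FW].
  have F0 : F 0 = W0 by exact: (FW (Ordinal (isT : (0 < 2)%N))).
  have F1 : F (1 / 2) = W1 by exact: (FW (Ordinal (isT : (1 < 2)%N))).
  apply: (no_interpolant m1 c_gt0 c_lt1 cE hF ballF); first by rewrite F0 W0p.
  by rewrite F1 W1p.
Qed.
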